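(* Let $(M^7,g_0,\eta_0,\Upsilon_0)$ be a contact Calabi--Yau 7-manifold with $\mathcal{D}_0=\ker\eta_0$ and $\omega_0=\mathrm{d}\eta_0$, let $\epsilon>0$, and let $\varphi_0=\epsilon\,\eta_0\wedge\omega_0+\operatorname{Re}\Upsilon_0$, a coclosed $\mathrm{G}_2$-structure with dual 4-form $\psi_0=\frac12\omega_0^2-\epsilon\,\eta_0\wedge\operatorname{Im}\Upsilon_0$. Put $q(t)=(1-8\epsilon^2t)^{-1/2}$ for $t\in(-\infty,\frac{1}{8\epsilon^2})$. Then the following family of coclosed $\mathrm{G}_2$-structures $\varphi_t$ on $M$, with associated dual 4-form $\psi_t$, metric $g_t$ and volume form $\mathrm{vol}_t$ given by \begin{align*} \varphi_t&=\epsilon\,q(t)\,\eta_0\wedge\omega_0+\operatorname{Re}\Upsilon_0,\\ \psi_t&=\tfrac12\omega_0^2-\epsilon\,q(t)\,\eta_0\wedge\operatorname{Im}\Upsilon_0,\\ g_t&=\epsilon^2q(t)^2\eta_0^2+g_{\mathcal{D}_0},\\ \mathrm{vol}_t&=\epsilon\,q(t)\,\eta_0\wedge\mathrm{vol}_{\mathcal{D}_0}, \end{align*} for $t\in(-\infty,\frac{1}{8\epsilon^2})$, solves the Laplacian flow $\frac{\partial\varphi_t}{\partial t}=\Delta_{\varphi_t}\varphi_t$ with initial data (at $t=0$) determined by $\varphi_0$. Hence the solution of the Laplacian flow is ancient (it exists for all negative times), with a finite time singularity (forwards in time) at $t=\frac{1}{8\epsilon^2}$.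
   Context: Contact Calabi--Yau (cCY) 7-manifold $(M^7,g_0,\eta_0,\Upsilon_0)$: $(M^7,g_0)$ is a Sasakian 7-manifold with contact form $\eta_0$; $\mathcal{D}_0=\ker\eta_0$ is the horizontal distribution with transverse complex structure $J$; $g_0=\eta_0^2+g_{\mathcal{D}_0}$ with $\eta_0^2=\eta_0\otimes\eta_0$ and $g_{\mathcal{D}_0}$ the transverse metric; the normalisation is that $\omega_0=\mathrm{d}\eta_0$ is the transverse K\''ahler form, $\omega_0=g_{\mathcal{D}_0}(J\cdot,\cdot)$; and $\Upsilon_0$ is a nowhere vanishing transverse $(3,0)$-form on $\mathcal{D}_0$ with $\mathrm{d}\Upsilon_0=0$ and $\frac{\omega_0^3}{3!}=\frac{i}{8}\Upsilon_0\wedge\overline{\Upsilon}_0$. Write $\mathrm{vol}_{\mathcal{D}_0}=\frac{1}{3!}\omega_0^3$. (The symbol $g_0$ denotes the given Sasakian metric; the flow metric at $t=0$ is $\epsilon^2\eta_0^2+g_{\mathcal{D}_0}$.) $\mathrm{G}_2$-structures: a $\mathrm{G}_2$-structure on $M^7$ is a 3-form $\varphi$ pointwise isomorphic to $e^{123}+e^{145}+e^{167}+e^{246}-e^{257}-e^{347}-e^{356}$ on $\mathbb{R}^7$. It determines a metric $g_\varphi$ and volume form $\mathrm{vol}_\varphi$ by $6g_\varphi(X,Y)\mathrm{vol}_\varphi=(X\lrcorner\varphi)\wedge(Y\lrcorner\varphi)\wedge\varphi$, hence a Hodge star $*_\varphi$ and dual 4-form $\psi=*_\varphi\varphi$. It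 is coclosed if $\mathrm{d}\psi=0$. In the Laplacian flow, $\Delta_{\varphi_t}=\mathrm{d}\mathrm{d}^{*_t}+\mathrm{d}^{*_t}\mathrm{d}$ is the (non-negative) Hodge Laplacian of $g_t=g_{\varphi_t}$ on 3-forms. A finite time singularity at an end point of the time interval means that the family of $\mathrm{G}_2$-structures degenerates there and cannot be continued to that time. *)

(* Defs.v *)
(* MathComp + MathComp-Analysis.

   A smooth 7-manifold is a topological manifold with a smooth atlas.  Tensor
   fields are represented in charts: a field is a family, indexed by the charts
   c, of tensor-valued functions on the open set [chart_codom c] of R^7, compatible
   under the changes of charts.  Values outside [chart_codom c] are irrelevant, so
   all (in)equalities between fields are asserted on [chart_codom c] only. *)
From HB Require Import structures.
From mathcomp Require Import all_boot all_order all_fingroup all_algebra complex.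
From mathcomp Require Import all_classical all_reals all_analysis.
Set Implicit Arguments.
Unset Strict Implicit.
Unset Printing Implicit Defensive.
Import Order.TTheory GRing.Theory Num.Theory.
Import numFieldNormedType.Exports.
Local Open Scope classical_set_scope.
Local Open Scope ring_scope.

Notation vec R := 'rV[R]_7.
Notation covec R K k := (('I_k -> vec R) -> K).

Section Smooth.
Context {R : realType} {V W : normedModType R}.

Fixpoint Ck_on (k : nat) (U : set V) (f : V -> W) : Prop :=
  match k with
  | 0%N => forall x, U x -> {for x, continuous f}
  | k'.+1 => (forall x, U x -> differentiable f x) /\
             (forall v, Ck_on k' U (fun x => 'D_v f x))
  end.

Definition smooth_on (U : set V) (f : V -> W) := forall k, Ck_on k U f.

End Smooth.

Record smooth_manifold7 (R : realType) := SmoothManifold7 {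
  carrier :> topologicalType;
  chart : Type;
  chart_dom : chart -> set carrier;
  chart_codom : chart -> set (vec R);
  chart_map : chart -> carrier -> vec R;
  chart_inv : chart -> vec R -> carrier;
  mfd_nonempty : [set: carrier] !=set0;
  mfd_hausdorff : hausdorff_space carrier;
  mfd_countable : @second_countable carrier;
  dom_open : forall c, open (chart_dom c);
  codom_open : forall c, open (chart_codom c);
  coord_codom : forall c p, chart_dom c p -> chart_codom c (chart_map c p);
  param_dom : forall c x, chart_codom c x -> chart_dom c (chart_inv c x);
  coordK : forall c p, chart_dom c p -> chart_inv c (chart_map c p) = p;
  paramK : forall c x, chart_codom c x -> chart_map c (chart_inv c x) = x;
  coord_continuous : forall c p, chart_dom c p -> {for p, continuous (chart_map c)};
  param_continuous : forall c x, chart_codom c x -> {for x, continuous (chart_inv c)};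
  dom_cover : forall p, exists c, chart_dom c p;
  transition_smooth : forall c c',
    smooth_on (chart_codom c `&` chart_inv c @^-1` chart_dom c') (chart_map c' \o chart_inv c)
}.

Section LinearAlgebra.
Context {R : realType}.
Local Notation V := (vec R).

Definition basis_vec (i : 'I_7) : V := delta_mx 0 i.

Definition multilinear k (f : covec R R k) :=
  forall (v : 'I_k -> V) (i : 'I_k) (a : R) (u w : V),
    f [eta v with i |-> a *: u + w] =
      a * f [eta v with i |-> u] + f [eta v with i |-> w].

Definition alternating k (f : covec R R k) :=
  forall (v : 'I_k -> V) (i j : 'I_k), i != j -> v i = v j -> f v = 0.

(* Determinant convention: (e^1 /\ e^2)(u, v) = u_1 v_2 - u_2 v_1. *)
Definition wedge_covec {K : fieldType} k l (a : covec R K k) (b : covec R K l) :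
    covec R K (k + l) :=
  fun v => (k`! * l`!)%:R^-1 *
    \sum_(s : 'S_(k + l)) (-1) ^+ s * a (fun i => v (s (lshift l i)))
                                    * b (fun j => v (s (rshift k j))).

Definition cons_vec k (u : V) (v : 'I_k -> V) : 'I_k.+1 -> V :=
  fun i => oapp v u (unlift ord0 i).

Definition contraction k (u : V) (a : covec R R k.+1) : covec R R k :=
  fun v => a (cons_vec u v).

(* e^{abc}, with indices running from 1 to 7. *)
Definition e3 (a b c : nat) : covec R R 3 :=
  fun v => \det (\matrix_(i < 3, j < 3)
                   (v i) 0 (inord (nth 0%N [:: a; b; c] j).-1 : 'I_7)).

Definition g2_model : covec R R 3 := fun v =>
  e3 1 2 3 v + e3 1 4 5 v + e3 1 6 7 v + e3 2 4 6 v
  - e3 2 5 7 v - e3 3 4 7 v - e3 3 5 6 v.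

Definition g2_covec (a : covec R R 3) :=
  exists2 A : 'M[R]_7, A \in unitmx &
    forall v, a v = g2_model (fun i => v i *m A).

Definition orthonormal (g : V -> V -> R) (f : 'I_7 -> V) :=
  forall i j, g (f i) (f j) = (i == j)%:R.

Definition inv_gram (g : V -> V -> R) : 'M[R]_7 :=
  invmx (\matrix_(i, j) g (basis_vec i) (basis_vec j)).

(* (star a)_{q_1..q_l} = 1/k! a^{p_1..p_k} vol_{p_1..p_k q_1..q_l}, indices being
   raised with g; for k + l = 7 this is the star operator characterised by
   b /\ star a = <b, a>_g vol. *)
Definition star_covec k l (g : V -> V -> R) (vol : covec R R 7)
    (a : covec R R k) : covec R R l :=
  fun v => (k`!)%:R^-1 *
    \sum_(p : {ffun 'I_k -> 'I_7}) \sum_(q : {ffun 'I_k -> 'I_7})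
      (\prod_(i < k) inv_gram g (p i) (q i)) *
      a (fun i => basis_vec (q i)) *
      vol (fun m : 'I_7 => nth 0 ([seq basis_vec (p i) | i <- enum 'I_k]
                                  ++ [seq v j | j <- enum 'I_l]) m).

End LinearAlgebra.

Section Fields.
Context {R : realType} {M : smooth_manifold7 R}.
Local Notation V := (vec R).

(* Values are taken in R^o rather than R for the R-module structure. *)
Definition cotensor (K : Type) k := chart M -> V -> covec R K k.
Definition dform k := cotensor R^o k.
Definition cform k := cotensor R[i] k.
Definition bilinear_field := chart M -> V -> V -> V -> R.
Definition vector_field := chart M -> V -> V.
Definition endo_field := chart M -> V -> V -> V.

Definition transition (c c' : chart M) : V -> V := chart_map c' \o chart_inv c.

Definition overlap (c c' : chart M) : set V :=
  chart_codom c `&` chart_inv c @^-1` chart_dom c'.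

Definition eq_on_M {K : Type} {k} (a b : cotensor K k) :=
  forall c x, chart_codom c x -> forall v, a c x v = b c x v.

Definition is_cotensor k (a : dform k) :=
  [/\ forall c x, chart_codom c x -> multilinear (a c x),
      forall c v, smooth_on (chart_codom c) (fun x => a c x v : R^o) &
      forall c c' x, overlap c c' x -> forall v,
        a c x v = a c' (transition c c' x)
                    (fun i => 'd (transition c c') x (v i))].

Definition is_form k (a : dform k) :=
  is_cotensor a /\ forall c x, chart_codom c x -> alternating (a c x).

Definition is_metric (g : bilinear_field) :=
  [/\ is_cotensor (fun c x (v : 'I_2 -> V) => g c x (v ord0) (v ord_max)),
      forall c x, chart_codom c x -> forall u v, g c x u v = g c x v u &
      forall c x, chart_codom c x -> forall u, u != 0 -> 0 < g c x u u].

Definition is_vector_field (X : vector_field) :=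
  (forall c, smooth_on (chart_codom c) (X c)) /\
  (forall c c' x, overlap c c' x ->
     X c' (transition c c' x) = 'd (transition c c') x (X c x)).

Definition is_endo_field (F : endo_field) :=
  [/\ forall c x, chart_codom c x -> forall a u v,
        F c x (a *: u + v) = a *: F c x u + F c x v,
      forall c u, smooth_on (chart_codom c) (fun x => F c x u) &
      forall c c' x, overlap c c' x -> forall u,
        F c' (transition c c' x) ('d (transition c c') x u) =
          'd (transition c c') x (F c x u)].

Definition eval1 (a : dform 1) c x (u : V) : R := a c x (fun=> u).
Definition eval2 (a : dform 2) c x (u v : V) : R := a c x (cons_vec u (fun=> v)).

Definition wedge_form {K : fieldType} k l (a : cotensor K k)
    (b : cotensor K l) : cotensor K (k + l) :=
  fun c x => wedge_covec (a c x) (b c x).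

(* In a chart, for constant v_0, .., v_k:
   (d a)(v_0, .., v_k) = \sum_i (-1)^i D_{v_i} (a(v_0, .., ^v_i, .., v_k)). *)
Definition ext_d k (a : dform k) : dform k.+1 :=
  fun c x v => \sum_(i < k.+1)
    (-1) ^+ i * 'D_(v i) (fun y => a c y (fun j => v (lift i j)) : R^o) x.

Definition closed_form k (a : dform k) :=
  forall c x, chart_codom c x -> forall v, ext_d a c x v = 0.

Definition re_form k (a : cform k) : dform k := fun c x v => complex.Re (a c x v).
Definition im_form k (a : cform k) : dform k := fun c x v => complex.Im (a c x v).
Definition conj_form k (a : cform k) : cform k := fun c x v => conjc (a c x v).
Definition cform_of k (a : dform k) : cform k :=
  fun c x v => real_complex R (a c x v).

Definition is_cform k (a : cform k) := is_form (re_form a) /\ is_form (im_form a).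

Definition closed_cform k (a : cform k) :=
  closed_form (re_form a) /\ closed_form (im_form a).

Definition lie_bracket (X Y : V -> V) : V -> V :=
  fun x => 'd Y x (X x) - 'd X x (Y x).

Definition nijenhuis (F : V -> V -> V) (X Y : V -> V) : V -> V :=
  let FX := fun x => F x (X x) in
  let FY := fun x => F x (Y x) in
  fun x => F x (F x (lie_bracket X Y x)) + lie_bracket FX FY x
           - F x (lie_bracket FX Y x) - F x (lie_bracket X FY x).

(* A Sasakian structure is a normal contact metric structure.  Normalisation:
   d eta = g(Phi ., .), where Phi is the transverse complex structure J on
   ker eta and Phi xi = 0.  Normality reads [Phi, Phi] + d eta (x) xi = 0 since
   d eta(X, Y) = X eta(Y) - Y eta(X) - eta([X, Y]) carries no factor 1/2. *)
Record sasakian (g : bilinear_field) (eta : dform 1)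
    (xi : vector_field) (Phi : endo_field) : Prop := Sasakian {
  sas_metric : is_metric g;
  sas_eta : is_form eta;
  sas_xi : is_vector_field xi;
  sas_Phi : is_endo_field Phi;
  sas_contact : forall c x, chart_codom c x -> exists v,
    wedge_form eta (wedge_form (ext_d eta)
      (wedge_form (ext_d eta) (ext_d eta))) c x v != 0;
  sas_eta_xi : forall c x, chart_codom c x -> eval1 eta c x (xi c x) = 1;
  sas_reeb : forall c x, chart_codom c x -> forall u,
    eval2 (ext_d eta) c x (xi c x) u = 0;
  sas_Phi2 : forall c x, chart_codom c x -> forall u,
    Phi c x (Phi c x u) = - u + eval1 eta c x u *: xi c x;
  sas_compatible : forall c x, chart_codom c x -> forall u v,
    g c x (Phi c x u) (Phi c x v) =
      g c x u v - eval1 eta c x u * eval1 eta c x v;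
  sas_kahler : forall c x, chart_codom c x -> forall u v,
    eval2 (ext_d eta) c x u v = g c x (Phi c x u) v;
  sas_normal : forall c (X Y : V -> V),
    smooth_on (chart_codom c) X -> smooth_on (chart_codom c) Y ->
    forall x, chart_codom c x ->
      nijenhuis (Phi c) X Y x
        + eval2 (ext_d eta) c x (X x) (Y x) *: xi c x = 0
}.

Definition transverse_metric (g : bilinear_field) (eta : dform 1) :
    bilinear_field :=
  fun c x u v => g c x u v - eval1 eta c x u * eval1 eta c x v.

Definition transverse_30 (eta : dform 1) (xi : vector_field) (Phi : endo_field)
    (Ups : cform 3) :=
  forall c x, chart_codom c x ->
    (forall v, Ups c x (cons_vec (xi c x) v) = 0) /\
    (forall v : 'I_3 -> V, (forall i, eval1 eta c x (v i) = 0) ->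
     forall i, Ups c x [eta v with i |-> Phi c x (v i)] =
               Complex 0 1 * Ups c x v).

Definition form_cube {K : fieldType} (w : cotensor K 2) : cotensor K 6 :=
  wedge_form (wedge_form w w) w.

Definition contact_calabi_yau (g : bilinear_field) (eta : dform 1)
    (Ups : cform 3) :=
  exists (xi : vector_field) (Phi : endo_field),
    [/\ sasakian g eta xi Phi,
        is_cform Ups /\ transverse_30 eta xi Phi Ups,
        forall c x, chart_codom c x -> exists v, Ups c x v != 0,
        closed_cform Ups &
        eq_on_M
          (fun c x v => (3`!)%:R^-1 * form_cube (cform_of (ext_d eta)) c x v)
          (fun c x v => Complex 0 1 / 8%:R *
                        wedge_form Ups (conj_form Ups) c x v)].

Definition volD (eta : dform 1) : dform 6 := (3`!)%:R^-1 *: form_cube (ext_d eta).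

Definition g2_structure (phi : dform 3) :=
  is_form phi /\ forall c x, chart_codom c x -> g2_covec (phi c x).

Definition is_volume_form (g : bilinear_field) (vol : dform 7) :=
  is_form vol /\
  forall c x, chart_codom c x ->
    forall f, orthonormal (g c x) f -> `|vol c x f| = 1.

(* g = g_phi and vol = vol_phi; the requirement that vol be a Riemannian volume
   form of g removes the scaling freedom left by the identity alone. *)
Definition g2_metric_volume (phi : dform 3) (g : bilinear_field)
    (vol : dform 7) :=
  [/\ is_metric g, is_volume_form g vol &
      forall c x, chart_codom c x -> forall (u w : V) (v : 'I_7 -> V),
        6%:R * g c x u w * vol c x v =
          wedge_covec (wedge_covec (contraction u (phi c x))
                                   (contraction w (phi c x)))
                      (phi c x) v].

Definition hodge (g : bilinear_field) (vol : dform 7) k l (a : dform k) :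
    dform l :=
  fun c x => @star_covec R k l (g c x) (vol c x) (a c x).

Arguments hodge g vol {k} l a.

(* On (k+1)-forms in dimension 7, the adjoint of d is (-1)^{k+1} star d star. *)
Definition codifferential (g : bilinear_field) (vol : dform 7) k
    (a : dform k.+1) : dform k :=
  (-1) ^+ k.+1 *: hodge g vol k (ext_d (hodge g vol (6 - k)%N a)).

Definition hodge_laplacian (g : bilinear_field) (vol : dform 7) k
    (a : dform k.+1) : dform k.+1 :=
  ext_d (codifferential g vol a) + codifferential g vol (ext_d a).

Definition coclosed_g2_structure (phi : dform 3) (g : bilinear_field)
    (vol : dform 7) (psi : dform 4) :=
  [/\ g2_structure phi, g2_metric_volume phi g vol,
      eq_on_M psi (hodge g vol 4 phi) & closed_form psi].

(* The pair (g, vol) is uniquely determined by phi t. *)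
Definition laplacian_flow (I : set R) (phi : R -> dform 3) :=
  forall t, I t ->
    g2_structure (phi t) /\
    exists g vol, g2_metric_volume (phi t) g vol /\
      forall c x, chart_codom c x -> forall v,
        is_derive t (1 : R) (fun s => phi s c x v : R^o)
          (hodge_laplacian g vol (phi t) c x v).

(* The first clause is degeneration at every point of M; the second excludes
   in particular any solution of the Laplacian flow defined up to or beyond T. *)
Definition finite_time_singularity (T : R) (phi : R -> dform 3) :=
  (forall c x, chart_codom c x ->
     ~ exists a : covec R R^o 3, g2_covec a /\
         forall v, phi t c x v @[t --> T^'-] --> a v) /\
  ~ exists phi' : R -> dform 3,
      [/\ forall t, t < T -> eq_on_M (phi' t) (phi t),
          g2_structure (phi' T) &
          forall c x, chart_codom c x -> forall v,
            phi' t c x v @[t --> T^'-] --> phi' T c x v].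

End Fields.

Arguments dform {R} M k.
Arguments cform {R} M k.
Arguments bilinear_field {R} M.

(* Main.v *)
(* At each point the Sasakian and Calabi-Yau structures admit a unitary frame: three
   horizontal vectors u_1, u_2, u_3, unitary for g and Phi, on which Upsilon = 1 (a
   rotation of u_3 achieves this, |Upsilon| = 1 being the volume identity).  In the
   coframe e^0 = lam eta, e^1, .., e^6 dual to it, with lam = eps q(t), all the forms
   have constant integer coefficients, so that the pointwise identities (the G2 metric
   identity, *phi = psi, *(omega^2 / 2) = lam eta /\ omega, omega /\ Im Upsilon = 0)
   become computations in an exterior algebra over the integers.  Since d omega = 0 and
   d Upsilon = 0, these give d psi = 0 and d phi = lam omega^2, hence
   Delta phi = d^* d phi = 4 lam^3 eta /\ omega; and lam = eps q solves
   lam' = 4 lam^3.  It blows up at T while eta /\ omega is nowhere zero, so phi_t has no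
   limit at any point. *)
Require Import Defs.

From mathcomp Require Import all_boot all_order all_fingroup all_algebra complex.
From mathcomp Require Import all_classical all_reals all_analysis.
From mathcomp Require Import ring lra zify.
Import Order.TTheory GRing.Theory Num.Theory.
Import numFieldNormedType.Exports.
Local Open Scope classical_set_scope.
Local Open Scope ring_scope.

Set Implicit Arguments.
Unset Strict Implicit.
Unset Printing Implicit Defensive.

(** * Forms built from a coframe and their wedge products *)

(** The adapted coframe is chosen anew at each point, with no regularity in the point, so it cannot
    be differentiated. Each pointwise identity is therefore restated as an equality of globally
    defined forms ([eta], [omega], the parts of [Ups]) on a whole chart image, and only then does
    [ext_d] act, through a Leibniz rule proved in chart coordinates. Wedge and star are sums over
    permutations and index maps, too large to unfold. They become computable because a monomial is a
    determinant, a wedge of monomials concatenates index lists, and the star of a monomial contracts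
    the volume monomial. The constant 4 is 2 times 2, since the star of omega^2 is taken twice; the
    three factors lam come from d phi and from the two stars. The rate 8 is then forced: lam' = 4
    lam^3 says (lam^-2)' = -8, and lam^-2 starts at eps^-2, hence vanishes at eps^-2 / 8. *)

Section BlockPerm.
Variables k l : nat.

(** The block action of S_k x S_l; it absorbs the permutations of the two factors of a wedge into
    the sum over S_(k+l). *)
Definition sum_perm_fun (a : 'S_k) (b : 'S_l) (x : 'I_(k + l)) : 'I_(k + l) :=
  match fintype.split x with inl i => lshift l (a i) | inr j => rshift k (b j) end.

Lemma sum_perm_subproof a b : injective (sum_perm_fun a b).
Proof.
move=> x y; rewrite /sum_perm_fun.
case: splitP => i xi; case: splitP => j yj.
- by move/lshift_inj/perm_inj => ij; apply: val_inj; rewrite /= xi yj ij.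
- by move/(congr1 val) => /= e; have := ltn_ord (a i); rewrite e ltnNge leq_addr.
- by move/(congr1 val) => /= e; have := ltn_ord (a j); rewrite -e ltnNge leq_addr.
- by move/rshift_inj/perm_inj => ij; apply: val_inj; rewrite /= xi yj ij.
Qed.

Definition sum_perm a b : 'S_(k + l) := perm (@sum_perm_subproof a b).

Lemma sum_perm_lshift a b i : sum_perm a b (lshift l i) = lshift l (a i).
Proof. by rewrite permE /sum_perm_fun -[lshift l i]/(unsplit (inl i)) unsplitK. Qed.

Lemma sum_perm_rshift a b i : sum_perm a b (rshift k i) = rshift k (b i).
Proof. by rewrite permE /sum_perm_fun -[rshift k i]/(unsplit (inr i)) unsplitK. Qed.

(** A sign is the determinant of a permutation matrix, and here that matrix is block diagonal. *)
Lemma sign_sum_perm (R : comPzRingType) a b :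
  (-1) ^+ sum_perm a b = (-1) ^+ a * (-1) ^+ b :> R.
Proof.
rewrite -!det_perm -(@det_lblock _ _ _ _ 0); congr (\det _).
apply/matrixP => x y; rewrite !mxE.
case: (splitP x) => i xi; rewrite !mxE.
  have -> : x = lshift l i by apply: val_inj.
  rewrite sum_perm_lshift; case: (splitP y) => j yj; rewrite !mxE.
    have -> : y = lshift l j by apply: val_inj.
    by rewrite eq_lshift.
  have -> : y = rshift k j by apply: val_inj.
  by rewrite eq_lrshift.
have -> : x = rshift k i by apply: val_inj.
rewrite sum_perm_rshift; case: (splitP y) => j yj; rewrite !mxE.
  have -> : y = lshift l j by apply: val_inj.
  by rewrite eq_rlshift.
have -> : y = rshift k j by apply: val_inj.
by rewrite eq_rshift.
Qed.

Definition cat_fun T (f : 'I_k -> T) (g : 'I_l -> T) (x : 'I_(k + l)) : T :=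
  match fintype.split x with inl i => f i | inr j => g j end.

Lemma cat_fun_lshift T (f : 'I_k -> T) (g : 'I_l -> T) i :
  cat_fun f g (lshift l i) = f i.
Proof. by rewrite /cat_fun -[lshift l i]/(unsplit (inl i)) unsplitK. Qed.

Lemma cat_fun_rshift T (f : 'I_k -> T) (g : 'I_l -> T) i :
  cat_fun f g (rshift k i) = g i.
Proof. by rewrite /cat_fun -[rshift k i]/(unsplit (inr i)) unsplitK. Qed.

End BlockPerm.

Section Eform.
Variables (K : comNzRingType) (J X : Type) (th : J -> X -> K).

(** The monomial th_(s_0) /\ .. /\ th_(s_(k-1)). The index type is arbitrary: it is used with
    coordinates indexed by ['I_7] and with coframes indexed by naturals, real or complex. *)
Definition eform k (s : 'I_k -> J) (v : 'I_k -> X) : K :=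
  \det (\matrix_(i, j) th (s j) (v i)).

Lemma eformE k (s : 'I_k -> J) v :
  eform s v = \sum_(a : 'S_k) (-1) ^+ a * \prod_i th (s i) (v (a i)).
Proof.
rewrite /eform -det_tr; apply: eq_bigr => a _; congr (_ * _).
by apply: eq_bigr => i _; rewrite !mxE.
Qed.

Lemma eform_perm_index k (s : 'I_k -> J) v (a : 'S_k) :
  eform (s \o a) v = (-1) ^+ a * eform s v.
Proof.
rewrite /eform -det_tr -[in RHS]det_tr -det_perm -det_mulmx -row_permE.
by congr (\det _); apply/matrixP => i j; rewrite !mxE.
Qed.

Lemma eform_repeat_index k (s : 'I_k -> J) v i j :
  i != j -> s i = s j -> eform s v = 0.
Proof.
move=> ij e; rewrite /eform -det_tr (determinant_alternate ij) // => x.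
by rewrite !mxE e.
Qed.

Lemma eform_repeat k (s : 'I_k -> J) v i j :
  i != j -> v i = v j -> eform s v = 0.
Proof.
move=> ij e; rewrite /eform (determinant_alternate ij) // => x.
by rewrite !mxE e.
Qed.

Lemma eform_contract k (s : 'I_k.+1 -> J) v :
  eform s v = \sum_(j < k.+1) (-1) ^+ j * th (s j) (v ord0) *
                eform (s \o lift j) (v \o lift ord0).
Proof.
rewrite {1}/eform (expand_det_row _ ord0); apply: eq_bigr => j _.
rewrite !mxE /cofactor add0n mulrA (mulrC (th _ _)); congr (_ * \det _).
by apply/matrixP => x y; rewrite !mxE.
Qed.

(** Expansion along the first column hands the first covector to each argument in turn, which is the
    alternating sum that defines [ext_d]. *)
Lemma eform_expand_first k (s : 'I_k.+1 -> J) v :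
  eform s v = \sum_(j < k.+1) (-1) ^+ j * th (s ord0) (v j) *
                eform (s \o lift ord0) (v \o lift j).
Proof.
rewrite {1}/eform (expand_det_col _ ord0); apply: eq_bigr => j _.
rewrite !mxE /cofactor addn0 mulrA (mulrC (th _ _)); congr (_ * \det _).
by apply/matrixP => x y; rewrite !mxE.
Qed.

End Eform.


Section Wedge.
Variables (R : realType) (K : numFieldType).
Local Notation V := (vec R).

(** Expanding both determinants gives a sum over r in S_(k+l), a in S_k, b in S_l. For fixed a and
    b, the substitution r -> [sum_perm a b] r yields the full determinant; the k! l! equal
    contributions cancel the normalisation. *)
Lemma wedge_eform (J : Type) (th : J -> V -> K) k l
    (s : 'I_k -> J) (t : 'I_l -> J) (v : 'I_(k + l) -> V) :
  wedge_covec (eform th s) (eform th t) v = eform th (cat_fun s t) v.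
Proof.
have mul5 (x y z p q : K) : z * (x * p * (y * q)) = x * y * z * (p * q) by ring.
rewrite /wedge_covec; apply: (@mulfI _ (k`! * l`!)%:R).
  by rewrite pnatr_eq0 -lt0n muln_gt0 !fact_gt0.
rewrite mulVKf; last by rewrite pnatr_eq0 -lt0n muln_gt0 !fact_gt0.
transitivity (\sum_(a : 'S_k) \sum_(b : 'S_l) eform th (cat_fun s t) v); last first.
  by rewrite !sumr_const !card_Sn -mulrnA mulnC mulr_natl.
transitivity (\sum_(r : 'S_(k + l)) \sum_(a : 'S_k) \sum_(b : 'S_l)
  ((-1) ^+ (sum_perm a b * r)%g * \prod_x th (cat_fun s t x) (v ((sum_perm a b * r)%g x)))).
  apply: eq_bigr => r _; rewrite !eformE -mulrA big_distrlr mulr_sumr /=.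
  apply: eq_bigr => a _; rewrite mulr_sumr; apply: eq_bigr => b _.
  rewrite odd_permM signr_addb sign_sum_perm big_split_ord /=.
  under [in RHS]eq_bigr do rewrite cat_fun_lshift permM sum_perm_lshift.
  under [X in _ = _ * (_ * X)]eq_bigr do rewrite cat_fun_rshift permM sum_perm_rshift.
  exact: mul5.
rewrite exchange_big; apply: eq_bigr => a _ /=.
rewrite exchange_big; apply: eq_bigr => b _ /=.
rewrite eformE [in RHS](reindex_inj (mulgI (sum_perm a b))).
by apply: eq_bigr.
Qed.

Lemma wedge_covecE k l (a : covec R K k) (b : covec R K l) v :
  wedge_covec a b v = (k`! * l`!)%:R^-1 *
    \sum_(s : 'S_(k + l)) (-1) ^+ s * (a (fun i => v (s (lshift l i)))
                                    * b (fun j => v (s (rshift k j)))).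
Proof. by congr (_ * _); apply: eq_bigr => s _; rewrite mulrA. Qed.

Lemma wedge_covec_suml (I : Type) (r : seq I) (P : pred I) k l
    (c : I -> K) (a : I -> covec R K k) (b : covec R K l) v :
  wedge_covec (fun w => \sum_(i <- r | P i) c i * a i w) b v =
  \sum_(i <- r | P i) c i * wedge_covec (a i) b v.
Proof.
have mul5 (n s x y z : K) : n * (s * (x * y * z)) = x * (n * (s * (y * z))) by ring.
rewrite wedge_covecE mulr_sumr.
under eq_bigr do rewrite mulr_suml !mulr_sumr.
rewrite exchange_big; apply: eq_bigr => i _ /=.
rewrite wedge_covecE !mulr_sumr; apply: eq_bigr => s _; exact: mul5.
Qed.

Lemma wedge_covec_sumr (I : Type) (r : seq I) (P : pred I) k l
    (c : I -> K) (a : covec R K k) (b : I -> covec R K l) v :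
  wedge_covec a (fun w => \sum_(i <- r | P i) c i * b i w) v =
  \sum_(i <- r | P i) c i * wedge_covec a (b i) v.
Proof.
have mul5 (n s x y z : K) : n * (s * (y * (x * z))) = x * (n * (s * (y * z))) by ring.
rewrite wedge_covecE mulr_sumr.
under eq_bigr do rewrite !mulr_sumr.
rewrite exchange_big; apply: eq_bigr => i _ /=.
rewrite wedge_covecE !mulr_sumr; apply: eq_bigr => s _; exact: mul5.
Qed.

Lemma wedge_covecZl k l c (a : covec R K k) (b : covec R K l) v :
  wedge_covec (fun w => c * a w) b v = c * wedge_covec a b v.
Proof.
have := wedge_covec_suml [:: tt] xpredT (fun=> c) (fun=> a) b v.
rewrite big_seq1 => <-; congr wedge_covec.
by apply/funext => w; rewrite big_seq1.
Qed.

Lemma wedge_covecZr k l c (a : covec R K k) (b : covec R K l) v :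
  wedge_covec a (fun w => c * b w) v = c * wedge_covec a b v.
Proof.
have := wedge_covec_sumr [:: tt] xpredT (fun=> c) a (fun=> b) v.
rewrite big_seq1 => <-; congr wedge_covec.
by apply/funext => w; rewrite big_seq1.
Qed.

End Wedge.

(** * Deciding identities between constant-coefficient forms *)

(** The list of the [(n, s)] stands for the sum of the [n th_(s_1) /\ .. /\ th_(s_k)],
    for any family [th] of linear functionals; [ieval] gives it this meaning. *)
Definition iform := seq (int * seq nat).

(** The boolean is the parity of the adjacent swaps performed; [None] signals a repeated index, for
    which the monomial vanishes. *)
Fixpoint signed_insert (a : nat) (s : seq nat) : option (bool * seq nat) :=
  if s is b :: s' then
    if (a < b)%N then Some (false, a :: s)
    else if a == b then None
    else if signed_insert a s' is Some (e, t) then Some (~~ e, b :: t) else None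
  else Some (false, [:: a]).

Fixpoint signed_sort (s : seq nat) : option (bool * seq nat) :=
  if s is a :: s' then
    if signed_sort s' is Some (e, t) then
      if signed_insert a t is Some (e', t') then Some (e (+) e', t') else None
    else None
  else Some (false, [::]).

Definition isort (p : iform) : iform :=
  pmap (fun m => if signed_sort m.2 is Some (e, t)
                 then Some (if e then - m.1 else m.1, t) else None) p.

Definition icoef (s : seq nat) (p : iform) : int :=
  foldr (fun m c => if m.2 == s then m.1 + c else c) 0 p.

(** Once index lists are sorted, equal monomials carry equal lists, so cancellation is mere addition
    of integers. *)
Definition izero (p : iform) : bool :=
  let q := isort p in all (fun m => icoef m.2 q == 0) q.

Definition iscale (c : int) (p : iform) : iform := [seq (c * m.1, m.2) | m <- p].

Definition iwedge (p q : iform) : iform :=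
  [seq (m.1 * n.1, m.2 ++ n.2) | m <- p, n <- q].

(** Interior product with the vector dual to index [a]: an occurrence at position j is deleted with
    sign (-1)^j. *)
Definition icontract (a : nat) (p : iform) : iform :=
  flatten [seq [seq ((if odd j then - m.1 else m.1), take j m.2 ++ drop j.+1 m.2)
               | j <- iota 0 (size m.2) & nth 0%N m.2 j == a] | m <- p].

Definition idegree (k : nat) (p : iform) : bool := all (fun m => size m.2 == k) p.

(** The degree tests matter: [emon] reads missing entries as index 0 and ignores surplus ones, so
    sorting preserves the value only for lists of length exactly [k]. *)
Definition ieq (k : nat) (p q : iform) : bool :=
  [&& idegree k p, idegree k q & izero (p ++ iscale (-1) q)].

Lemma idegree_contract k a p : idegree k.+1 p -> idegree k (icontract a p).
Proof.
move=> /allP dp; apply/allP => m /flattenP[_ /mapP[n np ->]] /mapP[j].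
have /eqP sn := dp _ np.
rewrite mem_filter mem_iota add0n sn => /and3P[_ _ jn] -> /=.
by rewrite size_cat size_take size_drop sn jn; apply/eqP; lia.
Qed.

(** * Soundness of the calculus on integer forms *)

Section Iform.
Variables (K : comNzRingType) (X : Type) (th : nat -> X -> K).

Definition emon k (s : seq nat) : ('I_k -> X) -> K :=
  eform th (fun i : 'I_k => nth 0%N s i).

Definition ieval k (p : iform) (v : 'I_k -> X) : K :=
  \sum_(m <- p) m.1%:~R * emon m.2 v.

Lemma emon_swap k (v : 'I_k -> X) s a b t : size (s ++ a :: b :: t) = k ->
  emon (s ++ a :: b :: t) v = - emon (s ++ b :: a :: t) v.
Proof.
rewrite size_cat /= => sk.
have ik : (size s < k)%N by rewrite -sk -addSnnS leq_addr.
have jk : ((size s).+1 < k)%N by rewrite -sk -addSnnS -addSnnS leq_addr.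
pose i := Ordinal ik; pose j := Ordinal jk.
have ij : i != j by rewrite -val_eqE /= neq_ltn leqnn.
rewrite /emon (_ : (fun i : 'I_k => nth 0%N (s ++ a :: b :: t) i) =
   (fun i : 'I_k => nth 0%N (s ++ b :: a :: t) i) \o tperm i j).
  by rewrite eform_perm_index odd_tperm ij mulN1r.
apply/funext => x /=; case: tpermP => [->|->|/eqP xi /eqP xj].
- by rewrite /= !nth_cat ltnn subnn /= ltnNge leqnSn /= subSnn.
- by rewrite /= !nth_cat ltnn subnn /= ltnNge leqnSn /= subSnn.
- rewrite !nth_cat; case: ltnP => // sx.
  move: xi xj; rewrite -!val_eqE /= => xi xj.
  have -> : (x - size s = (x - (size s).+2).+2)%N by lia.
  by [].
Qed.

Lemma emon_repeat k (v : 'I_k -> X) s a t : size (s ++ a :: a :: t) = k ->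
  emon (s ++ a :: a :: t) v = 0.
Proof.
rewrite size_cat /= => sk.
have ik : (size s < k)%N by rewrite -sk -addSnnS leq_addr.
have jk : ((size s).+1 < k)%N by rewrite -sk -addSnnS -addSnnS leq_addr.
apply: (@eform_repeat_index _ _ _ _ _ _ _ (Ordinal ik) (Ordinal jk)).
  by rewrite -val_eqE /= neq_ltn leqnn.
by rewrite /= !nth_cat ltnn subnn /= ltnNge leqnSn /= subSnn.
Qed.

(** The prefix [s] lets the induction move [a] rightwards by adjacent swaps inside a monomial of
    fixed degree. *)
Lemma emon_insert k (v : 'I_k -> X) s a t : size (s ++ a :: t) = k ->
  emon (s ++ a :: t) v =
  if signed_insert a t is Some (e, u) then (-1) ^+ e * emon (s ++ u) v else 0.
Proof.
elim: t s => [|b t IH] s /= sk; first by rewrite mul1r.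
case: ifP => [_|_]; first by rewrite mul1r.
case: eqP => [ab|_]; first by rewrite -ab in sk *; exact: emon_repeat.
rewrite emon_swap // -cat_rcons IH; last by rewrite -sk cat_rcons !size_cat.
case: signed_insert => [[e u]|]; rewrite ?oppr0 // cat_rcons signrN.
by rewrite mulNr.
Qed.

Lemma size_signed_insert a t :
  if signed_insert a t is Some (e, u) then size u = (size t).+1 else True.
Proof.
elim: t => //= b t; case: ifP => // _; case: ifP => // _.
by case: signed_insert => // -[e u] /= ->.
Qed.

Lemma size_signed_sort s :
  if signed_sort s is Some (e, u) then size u = size s else True.
Proof.
elim: s => //= a s; case: signed_sort => // -[e u] us.
have := size_signed_insert a u; case: signed_insert => // -[e' u'] ->.
by rewrite us.
Qed.

Lemma emon_sort k (v : 'I_k -> X) s t : size (s ++ t) = k ->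
  emon (s ++ t) v =
  if signed_sort t is Some (e, u) then (-1) ^+ e * emon (s ++ u) v else 0.
Proof.
elim: t s => [|a t IH] s /= sk; first by rewrite mul1r.
rewrite -cat_rcons IH ?cat_rcons //.
have := size_signed_sort t.
case: signed_sort => // -[e u] ut; rewrite cat_rcons emon_insert; last first.
  by rewrite -sk !size_cat /= ut.
by case: signed_insert => [[e' u']|]; rewrite ?mulr0 // mulrA signr_addb.
Qed.

Lemma ieval_cat k (v : 'I_k -> X) p q : ieval (p ++ q) v = ieval p v + ieval q v.
Proof. exact: big_cat. Qed.

Lemma ieval_scale k (v : 'I_k -> X) c p : ieval (iscale c p) v = c%:~R * ieval p v.
Proof.
rewrite /ieval big_map mulr_sumr; apply: eq_bigr => m _.
by rewrite /= intrM mulrA.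
Qed.

Lemma ieval_sort k (v : 'I_k -> X) p : idegree k p -> ieval (isort p) v = ieval p v.
Proof.
rewrite /ieval; elim: p => [|m p IH] //= /andP[/eqP sm /IH{}IH].
rewrite big_cons -IH (emon_sort v (s := [::])) // /isort /=.
case: signed_sort => [[e u]|] /=; last by rewrite mulr0 add0r.
by rewrite big_cons; case: e; rewrite /= ?mulN1r ?mul1r // intrN mulrN mulNr.
Qed.

(** Terms are grouped by index list; each group is one monomial times its total coefficient. *)
Lemma ieval_coef0 k (v : 'I_k -> X) p :
  all (fun m => icoef m.2 p == 0) p -> ieval p v = 0.
Proof.
move=> /allP p0.
have icoefE s : icoef s p = \sum_(m <- p | m.2 == s) m.1.
  by rewrite /icoef; elim: p {p0} => [|m p IH] /=; rewrite ?big_nil // big_cons IH.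
transitivity (\sum_(s <- undup (map snd p)) \sum_(m <- p | m.2 == s)
  m.1%:~R * emon m.2 v).
  rewrite (exchange_big_dep xpredT) //= /ieval; apply: eq_big_seq => m mp.
  rewrite -big_filter (_ : [seq i <- _ | _] = [:: m.2]) ?big_seq1 //.
  rewrite (eq_filter (a2 := pred1 m.2)) => [|s]; last by rewrite /= eq_sym.
  by rewrite filter_pred1_uniq ?undup_uniq // mem_undup map_f.
rewrite big_seq big1 // => s; rewrite mem_undup => /mapP[m0 m0p ->].
under eq_bigr => m /eqP -> do over.
rewrite -mulr_suml -(rmorph_sum (intmul 1)) -icoefE.
by rewrite (eqP (p0 _ m0p)) mul0r.
Qed.

(** The reflection principle: a computation on integer lists proves an identity of forms for every
    family [th], over any commutative ring. *)
Lemma ieval_eq k (v : 'I_k -> X) p q : ieq k p q -> ieval p v = ieval q v.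
Proof.
move=> /and3P[dp dq pq0]; apply/eqP; rewrite -subr_eq0 -mulN1r.
rewrite -[-1](mulrN1z 1) -ieval_scale -ieval_cat -ieval_sort.
  by rewrite ieval_coef0.
by rewrite /idegree all_cat [all _ p]dp /iscale all_map.
Qed.

(** In the Laplace expansion along the first argument, only the positions that hold the index [a]
    survive. *)
Lemma ieval_contract k (v : 'I_k.+1 -> X) a p :
  idegree k.+1 p -> (forall i, th i (v ord0) = (i == a)%:R) ->
  ieval p v = ieval (icontract a p) (v \o lift ord0).
Proof.
move=> /allP dp tha; rewrite /ieval /icontract big_flatten big_map.
apply: eq_big_seq => -[c s] /dp /= /eqP sk.
rewrite big_map big_filter big_mkcond /= sk.
rewrite -[iota 0 k.+1]/(index_iota 0 k.+1) big_mkord.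
rewrite /emon eform_contract mulr_sumr; apply: eq_bigr => j _.
rewrite tha; case: eqP => _; last by rewrite mulr0 mul0r mulr0.
rewrite mulr1 mulrA; congr (_ * _).
  by rewrite -signr_odd; case: (odd j); rewrite ?mulrN1 ?mulr1 // intrN.
congr (eform th _ _); apply/funext => i /=; rewrite nth_cat size_takel ?sk; last exact: ltnW.
rewrite /bump; case: ltnP => ij.
  by rewrite nth_take // leqNgt ij.
by rewrite nth_drop addSn subnKC // ij.
Qed.

End Iform.

Lemma wedge_emon (R : realType) (K : numFieldType) (th : nat -> vec R -> K) k l s t
    (v : 'I_(k + l) -> vec R) : size s = k ->
  wedge_covec (emon th s : covec R K k) (emon th t : covec R K l) v = emon th (s ++ t) v.
Proof.
move=> sk; rewrite wedge_eform; congr (eform _ _ _).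
apply/funext => i; rewrite /cat_fun nth_cat; case: splitP => j ->; rewrite sk.
  by rewrite ltn_ord.
by rewrite ltnNge leq_addr /= addnC addnK.
Qed.

Lemma ieval_wedge (R : realType) (K : numFieldType) (th : nat -> vec R -> K) k l p q
    (v : 'I_(k + l) -> vec R) : idegree k p ->
  wedge_covec (@ieval _ _ th k p) (@ieval _ _ th l q) v = ieval th (iwedge p q) v.
Proof.
move=> /allP dp; rewrite /ieval wedge_covec_suml /iwedge big_allpairs_dep.
apply: eq_big_seq => m /dp /eqP mk.
rewrite wedge_covec_sumr mulr_sumr; apply: eq_bigr => n _.
by rewrite wedge_emon // mulrA intrM.
Qed.

(** * Alternating multilinear maps *)

Section Alternating.
Context {R : realType}.
Local Notation V := (vec R).

Lemma cons_vec0 k (u : V) (v : 'I_k -> V) : cons_vec u v ord0 = u.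
Proof. by rewrite /cons_vec unlift_none. Qed.

Lemma cons_vec_lift k (u : V) (v : 'I_k -> V) i : cons_vec u v (lift ord0 i) = v i.
Proof. by rewrite /cons_vec liftK. Qed.

Lemma cons_vec_eta k (v : 'I_k.+1 -> V) : cons_vec (v ord0) (v \o lift ord0) = v.
Proof.
apply/funext => i; case: (unliftP ord0 i) => [j ->|->].
  by rewrite cons_vec_lift.
by rewrite cons_vec0.
Qed.

Lemma cons_vec_with0 k (u w : V) (v : 'I_k -> V) :
  cons_vec u v = [eta cons_vec w v with ord0 |-> u].
Proof.
apply/funext => i; case: (unliftP ord0 i) => [j ->|->] /=.
  by rewrite !cons_vec_lift.
by rewrite cons_vec0.
Qed.

Lemma cons_vec_with_lift k (u w : V) (v : 'I_k -> V) i :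
  cons_vec u [eta v with i |-> w] = [eta cons_vec u v with lift ord0 i |-> w].
Proof.
apply/funext => j; case: (unliftP ord0 j) => [j' ->|->] /=.
  by rewrite !cons_vec_lift /= (inj_eq lift_inj).
by rewrite !cons_vec0.
Qed.

Lemma multilinear_contraction k (f : covec R R k.+1) u :
  multilinear f -> multilinear (Defs.contraction u f).
Proof. by move=> fM v i a x y; rewrite /Defs.contraction !cons_vec_with_lift fM. Qed.

Lemma multilinear_cons_sum k (f : covec R R k.+1) (I : finType) (c : I -> R)
    (u : I -> V) v : multilinear f ->
  f (cons_vec (\sum_m c m *: u m) v) = \sum_m c m * f (cons_vec (u m) v).
Proof.
move=> fM; have step a x y : f (cons_vec (a *: x + y) v) =
    a * f (cons_vec x v) + f (cons_vec y v).
  rewrite (cons_vec_with0 _ 0) fM.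
  by rewrite -(cons_vec_with0 x) -(cons_vec_with0 y).
have f0 : f (cons_vec 0 v) = 0.
  have := step 1 0 0; rewrite scale1r addr0 mul1r => /eqP.
  by rewrite -subr_eq subrr eq_sym => /eqP.
elim/big_rec2: _ => [|m r s _ <-]; [exact: f0|exact: step].
Qed.

Lemma multilinear_expand k (f : covec R R k) (I : finType) (c : 'I_k -> I -> R)
    (u : I -> V) : multilinear f ->
  f (fun i => \sum_m c i m *: u m) =
  \sum_(p : {ffun 'I_k -> I}) (\prod_i c i (p i)) * f (fun i => u (p i)).
Proof.
elim: k f c => [|k IH] f c fM.
  rewrite (eq_bigr (fun=> f (fun i => \sum_m c i m *: u m))); last first.
    move=> p _; rewrite big_ord0 mul1r; congr (f _).
    by apply/funext => -[].
  by rewrite sumr_const card_ffun card_ord expn0.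
rewrite -[X in f X]cons_vec_eta /= multilinear_cons_sum //.
(* An index map on k+1 slots is a first index together with a map on the remaining slots. *)
rewrite (reindex (fun mq : I * {ffun 'I_k -> I} =>
  [ffun i => oapp mq.2 mq.1 (unlift ord0 i)])) /=; last first.
  exists (fun p : {ffun 'I_k.+1 -> I} => (p ord0, [ffun i => p (lift ord0 i)])).
    move=> [m q] _ /=; rewrite ffunE unlift_none; congr (_, _).
    by apply/ffunP => i; rewrite !ffunE liftK.
  move=> p _; apply/ffunP => i; rewrite ffunE.
  by case: unliftP => [j ->|->] /=; rewrite ?ffunE.
rewrite -(pair_bigA _ (fun (m : I) (q : {ffun 'I_k -> I}) => (\prod_i c i ([ffun i => oapp q m (unlift ord0 i)] i)) *
  f (fun i => u ([ffun i => oapp q m (unlift ord0 i)] i)))) /=.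
apply: eq_bigr => m _.
rewrite -[f _]/(Defs.contraction (u m) f _) (IH _ (fun i => c (lift ord0 i))); last first.
  exact: multilinear_contraction.
rewrite mulr_sumr; apply: eq_bigr => q _.
rewrite big_ord_recl ffunE unlift_none /= mulrA; congr (_ * _ * _).
  by apply: eq_bigr => i _; rewrite ffunE liftK.
congr (f _); apply/funext => i; rewrite ffunE /cons_vec.
by case: unlift.
Qed.

(** Polarisation: [f] vanishes when [v i + v j] stands in both slots, and of the four resulting
    terms the two diagonal ones vanish too. *)
Lemma alternating_tperm k (f : covec R R k) v i j :
  multilinear f -> Defs.alternating f -> i != j ->
  f (v \o tperm i j) = - f v.
Proof.
move=> fM fA ij; pose w x y : 'I_k -> V := [eta [eta v with i |-> x] with j |-> y].
have wE x y : w x y = [eta [eta v with j |-> y] with i |-> x].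
  apply/funext => m; rewrite /w /=; case: (m =P j) => [->|//].
  by rewrite eq_sym (negbTE ij).
have f0 x : f (w x x) = 0.
  by apply: (fA _ i j) => //; rewrite /w /= (negbTE ij) !eqxx.
have fD x y z : f (w (x + y) z) = f (w x z) + f (w y z).
  by have := fM [eta v with j |-> z] i 1 x y; rewrite scale1r mul1r -!wE.
have fD' x y z : f (w z (x + y)) = f (w z x) + f (w z y).
  by have := fM [eta v with i |-> z] j 1 x y; rewrite scale1r mul1r.
have -> : v \o tperm i j = w (v j) (v i).
  apply/funext => m; rewrite /w /=; case: tpermP => [->|->|/eqP mi /eqP mj].
  - by rewrite (negbTE ij) eqxx.
  - by rewrite eqxx.
  - by rewrite (negbTE mi) (negbTE mj).
have {3}-> : v = w (v i) (v j).
  apply/funext => m; rewrite /w /=; case: (m =P j) => [->|_] //.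
  by case: (m =P i) => [->|].
apply/eqP; rewrite -addr_eq0; apply/eqP.
have := f0 (v i + v j).
by rewrite fD !fD' !f0 add0r addr0 addrC.
Qed.

Lemma alternating_perm k (f : covec R R k) v (s : 'S_k) :
  multilinear f -> Defs.alternating f -> f (v \o s) = (-1) ^+ s * f v.
Proof.
move=> fM fA; have [ts -> tsP] := prod_tpermP s.
elim: ts v tsP => [|t ts IH] v /=.
  rewrite big_nil odd_perm1 mul1r => _; congr (f _).
  by apply/funext => i /=; rewrite perm1.
move=> /andP[dt /IH{}IH]; rewrite big_cons odd_permM signr_addb odd_tperm dt.
rewrite mulN1r mulNr -IH -(alternating_tperm _ fM fA dt); congr (f _).
by apply/funext => i /=; rewrite permM.
Qed.

(** Each permutation in the determinants turns the sum into the multilinear expansion of [f] at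
    permuted arguments, which is [f v] again after the sign. The sum runs over all index maps, not
    only increasing ones, hence the factor 1/k!. *)
Lemma alternating_expand k (f : covec R R k) (I : finType) (th : I -> V -> R)
    (u : I -> V) : multilinear f -> Defs.alternating f ->
  (forall v, v = \sum_m th m v *: u m) ->
  forall v, f v = (k`!)%:R^-1 *
    \sum_(p : {ffun 'I_k -> I}) f (fun i => u (p i)) * eform th p v.
Proof.
move=> fM fA uth v; apply: (@mulfI _ (k`!)%:R); first by rewrite pnatr_eq0 -lt0n fact_gt0.
rewrite mulVKf; last by rewrite pnatr_eq0 -lt0n fact_gt0.
under eq_bigr do rewrite eformE mulr_sumr.
rewrite exchange_big /= (eq_bigr (fun=> f v)) => [|s _].
  by rewrite sumr_const card_Sn mulr_natl.
rewrite (eq_bigr (fun p : {ffun 'I_k -> I} => (-1) ^+ s *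
  ((\prod_i th (p i) (v (s i))) * f (fun i => u (p i))))); last first.
  by move=> p _; rewrite mulrCA; congr (_ * _); rewrite mulrC.
rewrite -mulr_sumr.
have /= <- := multilinear_expand (fun i m => th m (v (s i))) u fM.
rewrite (_ : (fun i => _) = v \o s); last by apply/funext => i; rewrite /= -uth.
by rewrite alternating_perm // mulrA -signr_addb addbb mul1r.
Qed.

Lemma eform_multilinear (J : Type) (th : J -> V -> R) k (s : 'I_k -> J) :
  (forall j, linear (th j : V -> R^o)) -> multilinear (eform th s).
Proof.
move=> thL v i a x y; rewrite /eform.
pose A w := \matrix_(m, j) th (s j) ([eta v with i |-> w] m).
rewrite -/(A _) (@determinant_multilinear _ _ _ (A x) (A y) i a 1) ?mul1r //.
- by rewrite scale1r; apply/rowP => j; rewrite !mxE /= eqxx thL.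
- by apply/matrixP => m j; rewrite !mxE /= eq_sym (negbTE (neq_lift _ _)).
- by apply/matrixP => m j; rewrite !mxE /= eq_sym (negbTE (neq_lift _ _)).
Qed.

Lemma eform_alternating (J : Type) (th : J -> V -> R) k (s : 'I_k -> J) :
  Defs.alternating (eform th s).
Proof. by move=> v i j; exact: eform_repeat. Qed.

Lemma multilinear_sum (I : Type) (r : seq I) (c : I -> R) k (f : I -> covec R R k) :
  (forall i, multilinear (f i)) ->
  multilinear (fun v => \sum_(i <- r) c i * f i v).
Proof.
move=> fM v i a x y; rewrite mulr_sumr -big_split; apply: eq_bigr => j _ /=.
by rewrite fM mulrDr mulrCA.
Qed.

Lemma alternating_sum (I : Type) (r : seq I) (c : I -> R) k (f : I -> covec R R k) :
  (forall i, Defs.alternating (f i)) ->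
  Defs.alternating (fun v => \sum_(i <- r) c i * f i v).
Proof.
by move=> fA v i j ij vij; rewrite big1 // => m _; rewrite (fA m v i j) // mulr0.
Qed.

Lemma multilinearZ c k (f : covec R R k) :
  multilinear f -> multilinear (fun v => c * f v).
Proof. by move=> fM v i a x y; rewrite fM mulrDr mulrCA. Qed.

Lemma alternatingZ c k (f : covec R R k) :
  Defs.alternating f -> Defs.alternating (fun v => c * f v).
Proof. by move=> fA v i j ij vij; rewrite (fA v i j) // mulr0. Qed.

Lemma multilinearD k (f h : covec R R k) :
  multilinear f -> multilinear h -> multilinear (fun v => f v + h v).
Proof. by move=> fM hM v i a x y; rewrite fM hM mulrDr addrACA. Qed.

Lemma alternatingD k (f h : covec R R k) :
  Defs.alternating f -> Defs.alternating h -> Defs.alternating (fun v => f v + h v).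
Proof. by move=> fA hA v i j ij vij; rewrite (fA v i j) // (hA v i j) // addr0. Qed.

Definition ccoord (i : 'I_7) (v : V) : R := v 0 i.

Lemma coord_expand (v : V) : v = \sum_m ccoord m v *: basis_vec m.
Proof. exact: row_sum_delta. Qed.

Lemma coord_linear i : linear (ccoord i : V -> R^o).
Proof. by move=> a u v; rewrite /ccoord !mxE. Qed.

(** A combination of determinants in place of a sum over permutations: multilinearity and
    alternation of the wedge can be read off. *)
Lemma wedge_expand k l (f : covec R R k) (h : covec R R l) v :
  multilinear f -> Defs.alternating f -> multilinear h -> Defs.alternating h ->
  wedge_covec f h v = (k`!)%:R^-1 * ((l`!)%:R^-1 *
  \sum_(pq : {ffun 'I_k -> 'I_7} * {ffun 'I_l -> 'I_7})
    f (fun i => basis_vec (pq.1 i)) * h (fun i => basis_vec (pq.2 i)) *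
    eform ccoord (cat_fun pq.1 pq.2) v).
Proof.
move=> fM fA hM hA.
rewrite {1}(_ : f = fun v => (k`!)%:R^-1 * \sum_(p : {ffun 'I_k -> 'I_7})
  f (fun i => basis_vec (p i)) * eform ccoord p v); last first.
  by apply/funext => w; exact: (alternating_expand fM fA coord_expand).
rewrite wedge_covecZl wedge_covec_suml; congr (_ * _).
rewrite {1}(_ : h = fun v => (l`!)%:R^-1 * \sum_(p : {ffun 'I_l -> 'I_7})
  h (fun i => basis_vec (p i)) * eform ccoord p v); last first.
  by apply/funext => w; exact: (alternating_expand hM hA coord_expand).
under eq_bigr do rewrite wedge_covecZr wedge_covec_sumr.
under eq_bigr do rewrite mulrCA mulr_sumr.
rewrite -mulr_sumr pair_bigA; congr (_ * _); apply: eq_bigr => -[p q] _ /=.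
by rewrite wedge_eform mulrA.
Qed.

Lemma wedge_multilinear k l (f : covec R R k) (h : covec R R l) :
  multilinear f -> Defs.alternating f -> multilinear h -> Defs.alternating h ->
  multilinear (wedge_covec f h).
Proof.
move=> fM fA hM hA.
have := multilinearZ (k`!)%:R^-1 (multilinearZ (l`!)%:R^-1 (multilinear_sum
  (index_enum _) (fun pq : {ffun 'I_k -> 'I_7} * {ffun 'I_l -> 'I_7} =>
    f (fun i => basis_vec (pq.1 i)) * h (fun i => basis_vec (pq.2 i)))
  (fun pq : {ffun 'I_k -> 'I_7} * {ffun 'I_l -> 'I_7} =>
    eform_multilinear (cat_fun pq.1 pq.2) coord_linear))).
by congr multilinear; apply/funext => v; rewrite wedge_expand.
Qed.

Lemma wedge_alternating k l (f : covec R R k) (h : covec R R l) :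
  multilinear f -> Defs.alternating f -> multilinear h -> Defs.alternating h ->
  Defs.alternating (wedge_covec f h).
Proof.
move=> fM fA hM hA v i j ij vij; rewrite !wedge_expand //.
rewrite big1 ?mulr0 // => pq _.
by rewrite (eform_repeat _ _ ij) // mulr0.
Qed.

End Alternating.

(** * The star operator in an orthonormal coframe *)

Section Frame.
Context {R : realType}.
Local Notation V := (vec R).
Variable A : 'M[R]_7.
Hypothesis unitA : A \in unitmx.

(** The covectors are the columns of [A], the dual frame the rows of [invmx A]. Indices are naturals
    because integer forms use them; the value 0 beyond index 6 keeps every member linear. *)
Definition coframe (n : nat) (v : V) : R :=
  if (n < 7)%N then (v *m A) 0 (inord n) else 0.

Definition frame (n : nat) : V := row (inord n) (invmx A).

Lemma coframe_linear n : linear (coframe n : V -> R^o).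
Proof.
move=> a u v; rewrite /coframe; case: ifP => _; last by rewrite scaler0 addr0.
by rewrite mulmxDl -scalemxAl !mxE.
Qed.

Lemma coframe_ord (i : 'I_7) v : coframe i v = (v *m A) 0 i.
Proof. by rewrite /coframe ltn_ord inord_val. Qed.

Lemma coframe_frame n m : (m < 7)%N -> coframe n (frame m) = (n == m)%:R.
Proof.
move=> m7; rewrite /coframe; case: ltnP => n7; last first.
  by case: eqP => // nm; move: n7; rewrite nm leqNgt m7.
rewrite /frame -row_mul mulVmx // !mxE -val_eqE /= !inordK //.
by rewrite eq_sym.
Qed.

Lemma coframe_expand v : v = \sum_(m < 7) coframe m v *: frame m.
Proof.
rewrite -[LHS](mulmxK unitA) mulmx_sum_row; apply: eq_bigr => m _.
by rewrite coframe_ord /frame inord_val.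
Qed.

Lemma emon_multilinear k s : multilinear (emon coframe s : covec R R k).
Proof. by apply: eform_multilinear => j; exact: coframe_linear. Qed.

Lemma ieval_multilinear k p : multilinear (ieval coframe p : covec R R k).
Proof.
exact: (multilinear_sum _ (fun m : int * seq nat => m.1%:~R) (fun m => emon_multilinear m.2)).
Qed.

Lemma ieval_alternating k p : Defs.alternating (ieval coframe p : covec R R k).
Proof.
apply: (@alternating_sum _ _ _ (fun m : int * seq nat => m.1%:~R) _
  (fun m => emon coframe m.2)) => m.
exact: eform_alternating.
Qed.

(** Each contraction consumes the current first argument, so the indices are contracted in list
    order. *)
Lemma ieval_contract_frames s l q (w : 'I_(size s + l) -> V) :
  idegree (size s + l) q -> all (ltn^~ 7) s ->
  (forall i : 'I_(size s), w (lshift l i) = frame (nth 0%N s i)) ->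
  ieval coframe q w =
  ieval coframe (foldl (fun q a => icontract a q) q s) (fun j => w (rshift (size s) j)).
Proof.
elim: s q w => [|a s IH] q w /=.
  by move=> _ _ _; congr ieval; apply/funext => j; congr w; apply: val_inj.
move=> dq /andP[a7 s7] wE.
have w0 : w ord0 = frame a.
  by rewrite -[RHS](wE ord0); congr w; apply: val_inj.
rewrite (@ieval_contract _ _ _ _ w a) //; last first.
  by move=> i; rewrite w0 coframe_frame.
rewrite IH //; first 1 last.
- exact: idegree_contract.
- move=> i /=; rewrite -[RHS](wE (lift ord0 i)); congr w.
  exact: val_inj.
- by congr ieval; apply/funext => j /=; congr w; apply: val_inj.
Qed.

(** This is the argument list of the volume form in [star_covec]. The length [n] is free, so that 7
    can be used where [k + l] is only provably equal to it. *)
Definition cat_vec n k l (u : 'I_k -> V) (v : 'I_l -> V) : 'I_n -> V :=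
  fun m => nth 0 ([seq u i | i <- enum 'I_k] ++ [seq v j | j <- enum 'I_l]) m.

Lemma cat_vec_lshift k l (u : 'I_k -> V) (v : 'I_l -> V) i :
  cat_vec (n := k + l) u v (lshift l i) = u i.
Proof.
rewrite /cat_vec nth_cat size_map size_enum_ord /= ltn_ord.
by rewrite (nth_map i) ?size_enum_ord // nth_ord_enum.
Qed.

Lemma cat_vec_rshift k l (u : 'I_k -> V) (v : 'I_l -> V) j :
  cat_vec (n := k + l) u v (rshift k j) = v j.
Proof.
rewrite /cat_vec nth_cat size_map size_enum_ord /= ltnNge leq_addr /= addnC addnK.
by rewrite (nth_map j) ?size_enum_ord // nth_ord_enum.
Qed.

Lemma cat_vec_with k l (u : 'I_k -> V) (v : 'I_l -> V) i x :
  cat_vec (n := k + l) [eta u with i |-> x] v =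
  [eta cat_vec (n := k + l) u v with lshift l i |-> x].
Proof.
apply/funext => m /=; case: (split_ordP m) => j ->.
  by rewrite !cat_vec_lshift /= eq_lshift.
by rewrite !cat_vec_rshift eq_rlshift.
Qed.

Lemma cat_vec_multilinear n k l (f : covec R R n) (v : 'I_l -> V) :
  (k + l = n)%N ->
  multilinear f -> multilinear (fun u : 'I_k -> V => f (cat_vec u v)).
Proof. by move=> kl; subst n => fM u i a x y; rewrite !cat_vec_with fM. Qed.

Lemma cat_vec_alternating n k l (f : covec R R n) (v : 'I_l -> V) :
  (k + l = n)%N ->
  Defs.alternating f -> Defs.alternating (fun u : 'I_k -> V => f (cat_vec u v)).
Proof.
move=> kl; subst n => fA u i j ij uij; apply: (fA _ (lshift l i) (lshift l j)).
  by rewrite eq_lshift.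
by rewrite !cat_vec_lshift.
Qed.

Lemma ieval_cat_vec_frames n l s q (v : 'I_l -> V) :
  (size s + l = n)%N -> idegree n q -> all (ltn^~ 7) s ->
  ieval coframe q (cat_vec (fun i : 'I_(size s) => frame (nth 0%N s i)) v : 'I_n -> V) =
  ieval coframe (foldl (fun q a => icontract a q) q s) v.
Proof.
move=> sl; subst n => dq s7; rewrite ieval_contract_frames // => [|i].
  by congr ieval; apply/funext => j; rewrite cat_vec_rshift.
by rewrite cat_vec_lshift.
Qed.

(** If the coframe is orthonormal, the Gram matrix is A A^T, with inverse (A^-1)^T A^-1. *)
Lemma inv_gram_coframe (g : V -> V -> R) p q :
  (forall u w, g u w = \sum_(m < 7) coframe m u * coframe m w) ->
  inv_gram g p q = \sum_(m < 7) frame m 0 p * frame m 0 q.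
Proof.
move=> gE; rewrite /inv_gram (_ : \matrix_(i, j) _ = A *m A^T); last first.
  apply/matrixP => i j; rewrite !mxE gE; apply: eq_bigr => m _.
  by rewrite !coframe_ord /basis_vec -!rowE !mxE.
have -> : invmx (A *m A^T) = (invmx A)^T *m invmx A.
  apply: (@row_full_inj _ _ _ _ (A *m A^T)).
    by rewrite row_full_unit unitmx_mul unitmx_tr unitA.
  rewrite mulmxV ?unitmx_mul ?unitmx_tr ?unitA //.
  rewrite mulmxA -(mulmxA A) -trmx_mul mulVmx // trmx1 mulmx1.
  by rewrite mulmxV.
by rewrite !mxE; apply: eq_bigr => m _; rewrite /frame inord_val !mxE.
Qed.

(** Raising indices with the inverse Gram matrix amounts to summing over an orthonormal frame: both
    [a] and [vol] are expanded in the coordinate basis, and the frame coordinates recombine into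
    inverse Gram entries. *)
Lemma star_covec_frame k l (g : V -> V -> R) (vol : covec R R 7)
    (a : covec R R k) v :
  (k + l = 7)%N ->
  (forall u w, g u w = \sum_(m < 7) coframe m u * coframe m w) ->
  multilinear a -> multilinear vol ->
  star_covec g vol a v = (k`!)%:R^-1 *
    \sum_(p : {ffun 'I_k -> 'I_7}) a (fun i => frame (p i)) *
       vol (cat_vec (fun i => frame (p i)) (v : 'I_l -> V)).
Proof.
move=> kl gE aM volM; rewrite /star_covec; congr (_ * _).
have frameE (m : 'I_7) : frame m = \sum_(q < 7) frame m 0 q *: basis_vec q.
  exact: row_sum_delta.
under [RHS]eq_bigr => r _.
  rewrite (_ : (fun i => frame (r i)) =
    fun i => \sum_q frame (r i) 0 q *: basis_vec q); last first.
    by apply/funext => i; rewrite -frameE.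
  rewrite (multilinear_expand (fun i q => frame (r i) 0 q)) //.
  have volM' : multilinear (fun u : 'I_k -> V => vol (cat_vec u v)).
    exact: cat_vec_multilinear.
  rewrite (multilinear_expand (fun i q => frame (r i) 0 q) _ volM').
  rewrite big_distrlr exchange_big /=.
  over.
rewrite [RHS]exchange_big; apply: eq_bigr => p _ /=.
rewrite [RHS]exchange_big; apply: eq_bigr => q _ /=.
under eq_bigr do rewrite (inv_gram_coframe _ _ gE).
rewrite bigA_distr_bigA /= !mulr_suml; apply: eq_bigr => r _.
rewrite big_split /=; ring.
Qed.

(** In an orthonormal coframe, the star of a monomial is the volume form with the dual vectors of
    its indices inserted first, in the order of the list. *)
Definition istar (p : iform) : iform :=
  flatten [seq iscale m.1 (foldl (fun q a => icontract a q) [:: (1, iota 0 7)] m.2)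
          | m <- p].

Definition ibounded (p : iform) : bool := all (fun m => all (ltn^~ 7%N) m.2) p.

(** The sum over frames is [alternating_expand] for the map u -> vol(u, v), evaluated at the frame
    vectors listed by [s]. *)
Lemma star_emon k l (g : V -> V -> R) s v :
  (k + l = 7)%N ->
  (forall u w, g u w = \sum_(m < 7) coframe m u * coframe m w) ->
  size s = k -> all (ltn^~ 7%N) s ->
  star_covec g (ieval coframe [:: (1, iota 0 7)]) (emon coframe s : covec R R k) v =
  ieval coframe (foldl (fun q a => icontract a q) [:: (1, iota 0 7)] s) (v : 'I_l -> V).
Proof.
move=> kl gE sk s7; rewrite (@star_covec_frame _ _ _ _ _ _ kl gE); first last.
- exact: ieval_multilinear.
- exact: emon_multilinear.
pose u (i : 'I_k) := frame (nth 0%N s i).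
transitivity (ieval coframe [:: (1, iota 0 7)] (cat_vec u v : 'I_7 -> V)).
  have M : multilinear (fun u : 'I_k -> V =>
      ieval coframe [:: (1, iota 0 7)] (cat_vec u v : 'I_7 -> V)).
    by apply: cat_vec_multilinear => //; exact: ieval_multilinear.
  have L : Defs.alternating (fun u : 'I_k -> V =>
      ieval coframe [:: (1, iota 0 7)] (cat_vec u v : 'I_7 -> V)).
    by apply: cat_vec_alternating => //; exact: ieval_alternating.
  rewrite (alternating_expand (th := fun m : 'I_7 => coframe m) M L coframe_expand u).
  congr (_ * _); apply: eq_bigr => p _; rewrite mulrC; congr (_ * _).
  rewrite /emon /eform -det_tr; congr (\det _); apply/matrixP => i j; rewrite !mxE.
  rewrite !coframe_frame 1?eq_sym ?ltn_ord //.
  by apply: (all_nthP 0%N s7); rewrite sk.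
by subst k; exact: ieval_cat_vec_frames.
Qed.

Lemma star_covec_sum (I : Type) (r : seq I) (c : I -> R) k l (g : V -> V -> R)
    (vol : covec R R 7) (a : I -> covec R R k) (v : 'I_l -> V) :
  star_covec g vol (fun w => \sum_(i <- r) c i * a i w) v =
  \sum_(i <- r) c i * star_covec g vol (a i) v.
Proof.
have mul5 (x y z t : R) : x * (y * z) * t = y * (x * z * t) by ring.
rewrite /star_covec; under [RHS]eq_bigr => m _ do rewrite mulrCA.
rewrite -mulr_sumr; congr (_ * _).
under [RHS]eq_bigr => m _ do rewrite mulr_sumr.
rewrite [RHS]exchange_big; apply: eq_bigr => p _ /=.
under [RHS]eq_bigr => m _ do rewrite mulr_sumr.
rewrite [RHS]exchange_big; apply: eq_bigr => q _ /=.
by rewrite mulr_sumr mulr_suml; apply: eq_bigr => m _; exact: mul5.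
Qed.

Lemma star_ieval k l (g : V -> V -> R) p v :
  (k + l = 7)%N ->
  (forall u w, g u w = \sum_(m < 7) coframe m u * coframe m w) ->
  idegree k p -> ibounded p ->
  star_covec g (ieval coframe [:: (1, iota 0 7)]) (ieval coframe p : covec R R k) v =
  ieval coframe (istar p) (v : 'I_l -> V).
Proof.
move=> kl gE /allP dp /allP p7.
rewrite {2}/ieval star_covec_sum {2}/ieval /istar big_flatten big_map.
apply: eq_big_seq => m mp; rewrite (star_emon _ kl) ?p7 //; last exact/eqP/dp.
by rewrite -/(ieval _ _ _) ieval_scale.
Qed.

End Frame.

(** * The model G2-structure *)

Definition iomega : iform := [:: (1, [:: 1; 2]%N); (1, [:: 3; 4]%N); (1, [:: 5; 6]%N)].
(* [ire] and [iim] are the parts of [z1 /\ z2 /\ z3] for [z_a = e^(2a-1) + i e^(2a)];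
   index 0 is the contact direction. *)
Definition ire : iform :=
  [:: (1, [:: 1; 3; 5]%N); (-1, [:: 1; 4; 6]%N); (-1, [:: 2; 3; 6]%N); (-1, [:: 2; 4; 5]%N)].
Definition iim : iform :=
  [:: (1, [:: 1; 3; 6]%N); (1, [:: 1; 4; 5]%N); (1, [:: 2; 3; 5]%N); (-1, [:: 2; 4; 6]%N)].
Definition ieta : iform := [:: (1, [:: 0%N])].
Definition ivol : iform := [:: (1, iota 0 7)].
Definition iphi : iform := iwedge ieta iomega ++ ire.

Section G2.
Context {R : realType}.
Local Notation V := (vec R).
Variable A : 'M[R]_7.
Hypothesis unitA : A \in unitmx.

Lemma emon_e3 (a b c : nat) (v : 'I_3 -> V) : (a < 7)%N -> (b < 7)%N -> (c < 7)%N ->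
  e3 a.+1 b.+1 c.+1 (fun i => v i *m A) = emon (coframe A) [:: a; b; c] v.
Proof.
move=> a7 b7 c7; rewrite /e3 /emon /eform; congr (\det _).
apply/matrixP => i j; rewrite !mxE /coframe.
by case: j => [[|[|[|//]]] jj] /=; rewrite ?a7 ?b7 ?c7 ?mxE.
Qed.

(** The model's e^1 becomes index 0, the contact direction: its three terms through e^1 form eta /\
    omega, and the other four form Re(z1 /\ z2 /\ z3). *)
Lemma g2_model_coframe v : g2_model (fun i => v i *m A) = ieval (coframe A) iphi v.
Proof.
rewrite /g2_model !emon_e3 // /ieval /iphi.
rewrite (_ : iwedge ieta iomega ++ ire = [:: (1, [:: 0; 1; 2]%N); (1, [:: 0; 3; 4]%N);
 (1, [:: 0; 5; 6]%N); (1, [:: 1; 3; 5]%N); (-1, [:: 1; 4; 6]%N);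
 (-1, [:: 2; 3; 6]%N); (-1, [:: 2; 4; 5]%N)]); last by vm_compute.
by rewrite !big_cons big_nil /= !mulrN1z !mulr1z; ring.
Qed.

Lemma star_phi (g : V -> V -> R) (v : 'I_4 -> V) :
  (forall u w, g u w = \sum_(m < 7) coframe A m u * coframe A m w) ->
  star_covec g (ieval (coframe A) ivol) (ieval (coframe A) iphi : covec R R 3) v =
  1 / 2%:R * ieval (coframe A) (iwedge iomega iomega) v -
  ieval (coframe A) (iwedge ieta iim) v.
Proof.
(* Integer forms cannot carry the 1/2, so the identity is doubled before the check. *)
move=> gE; rewrite star_ieval //; apply: (@mulfI _ 2%:R); first by rewrite pnatr_eq0.
rewrite mulrBr mul1r mulrA divff ?pnatr_eq0 // mul1r -mulNr -[2%:R]/(2%:~R) -intrN.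
rewrite -!ieval_scale -ieval_cat.
by apply: ieval_eq; vm_compute.
Qed.

Lemma star_omega2 (g : V -> V -> R) (v : 'I_3 -> V) :
  (forall u w, g u w = \sum_(m < 7) coframe A m u * coframe A m w) ->
  star_covec g (ieval (coframe A) ivol)
    (ieval (coframe A) (iwedge iomega iomega) : covec R R 4) v =
  2%:R * ieval (coframe A) (iwedge ieta iomega) v.
Proof.
move=> gE; rewrite star_ieval // -[2%:R]/(2%:~R) -ieval_scale.
by apply: ieval_eq; vm_compute.
Qed.

Lemma omega_wedge_im (v : 'I_5 -> V) : ieval (coframe A) (iwedge iomega iim) v = 0.
Proof.
by rewrite (@ieval_eq _ _ _ 5 v _ [::]) ?/ieval ?big_nil //; vm_compute.
Qed.

Lemma eta_omega3 (v : 'I_7 -> V) :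
  ieval (coframe A) (iwedge ieta (iwedge (iwedge iomega iomega) iomega)) v =
  6%:R * ieval (coframe A) ivol v.
Proof.
rewrite -[6%:R]/(6%:~R) -ieval_scale.
by apply: ieval_eq; vm_compute.
Qed.

Lemma contraction_expand k (f : covec R R k.+1) u : multilinear f ->
  Defs.contraction u f =
  (fun w => \sum_(m < 7) coframe A m u * Defs.contraction (frame A m) f w).
Proof.
move=> fM; apply/funext => w; rewrite /Defs.contraction.
by rewrite {1}(coframe_expand unitA u) multilinear_cons_sum.
Qed.

Lemma contraction_frame k p (m : 'I_7) : idegree k.+1 p ->
  Defs.contraction (frame A m) (ieval (coframe A) p : covec R R k.+1) =
  ieval (coframe A) (icontract m p).
Proof.
move=> dp; apply/funext => w; rewrite /Defs.contraction.
rewrite (@ieval_contract _ _ _ _ _ m) // => [|i].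
  by congr ieval; apply/funext => i /=; rewrite cons_vec_lift.
by rewrite cons_vec0 coframe_frame.
Qed.

(** The G2 metric identity is bilinear in the two contracted vectors, so the 49 pairs of frame
    vectors suffice. *)
Lemma g2_identity_check : all (fun i => all (fun j =>
  ieq 7 (iwedge (iwedge (icontract i iphi) (icontract j iphi)) iphi)
        (iscale (6 * (i == j)%:Z) ivol)) (iota 0 7)) (iota 0 7).
Proof. by vm_compute. Qed.

Lemma g2_identity (g : V -> V -> R) (u w : V) (v : 'I_7 -> V) :
  (forall u w, g u w = \sum_(m < 7) coframe A m u * coframe A m w) ->
  6%:R * g u w * ieval (coframe A) ivol v =
  wedge_covec (wedge_covec
     (Defs.contraction u (ieval (coframe A) iphi : covec R R 3))
     (Defs.contraction w (ieval (coframe A) iphi : covec R R 3)))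
    (ieval (coframe A) iphi) v.
Proof.
move=> gE; have phiM := @ieval_multilinear R A 3 iphi.
rewrite [in RHS](contraction_expand u phiM) [in RHS](contraction_expand w phiM).
pose W i j := wedge_covec (ieval (coframe A) (icontract i iphi) : covec R R 2)
  (ieval (coframe A) (icontract j iphi) : covec R R 2).
rewrite (_ : wedge_covec _ _ = fun x => \sum_(i < 7) coframe A i u *
    (\sum_(j < 7) coframe A j w * W i j x)); last first.
  apply/funext => x; rewrite wedge_covec_suml; apply: eq_bigr => i _.
  congr (_ * _); rewrite wedge_covec_sumr; apply: eq_bigr => j _.
  by rewrite !contraction_frame.
rewrite wedge_covec_suml gE [6%:R * _]mulr_sumr [LHS]mulr_suml; apply: eq_bigr => i _.
rewrite wedge_covec_suml.
(* The diagonal sum is written as a double sum with a Kronecker delta, to be matched pair by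
   pair. *)
transitivity (coframe A i u * \sum_(j < 7) coframe A j w *
  ((6 * (val i == val j)%:Z)%:~R * ieval (coframe A) ivol v)).
  rewrite (bigD1 i) //= eqxx big1 ?addr0 => [|j /negbTE ji].
    by move: (ieval _ _ _) => x; rewrite -[6%:~R]/(6%:R : R); ring.
  by rewrite eq_sym [_ == _]ji mulr0 mulr0z mul0r mulr0.
congr (_ * _); apply: eq_bigr => j _; congr (_ * _).
rewrite (_ : W i j = ieval (coframe A)
  (iwedge (icontract i iphi) (icontract j iphi))); last first.
  by apply/funext => x; rewrite /W ieval_wedge // (@idegree_contract 2).
rewrite ieval_wedge; last first.
  have dc (m : nat) : idegree 2 (icontract m iphi) by rewrite (@idegree_contract 2).
  apply/allP => m /allpairsP[[x y] /= [xi yj ->]] /=.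
  by rewrite size_cat (eqP (allP (dc i) _ xi)) (eqP (allP (dc j) _ yj)).
rewrite -ieval_scale; apply/esym/ieval_eq.
have /allP/(_ i) := g2_identity_check.
rewrite mem_iota ltn_ord => /(_ isT) /allP/(_ j).
by rewrite mem_iota ltn_ord => /(_ isT).
Qed.

End G2.

(** * Complex three-forms *)

Lemma emon2E (K : comNzRingType) (X : Type) (th : nat -> X -> K) n m (v : 'I_2 -> X) :
  emon th [:: n; m] v =
  th n (v ord0) * th m (v ord_max) - th m (v ord0) * th n (v ord_max).
Proof.
rewrite /emon /eform (expand_det_row _ ord0) !big_ord_recl big_ord0 /cofactor.
rewrite !det_mx11 !mxE (_ : lift ord0 0 = ord_max) /=; last exact: val_inj.
by rewrite /bump /= expr0 expr1 mul1r mulN1r mulrN addr0.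
Qed.

Section ComplexParts.
Context {R : realType}.
Implicit Types x y : R[i].

Lemma complexP x y : complex.Re x = complex.Re y -> complex.Im x = complex.Im y -> x = y.
Proof. by case: x y => [a b] [c d] /= -> ->. Qed.

Lemma cReD x y : complex.Re (x + y) = complex.Re x + complex.Re y.
Proof. by case: x y => [a b] [c d]. Qed.

Lemma cImD x y : complex.Im (x + y) = complex.Im x + complex.Im y.
Proof. by case: x y => [a b] [c d]. Qed.

Lemma cReN x : complex.Re (- x) = - complex.Re x.
Proof. by case: x. Qed.

Lemma cImN x : complex.Im (- x) = - complex.Im x.
Proof. by case: x. Qed.

Lemma cReM x y : complex.Re (x * y) =
  complex.Re x * complex.Re y - complex.Im x * complex.Im y.
Proof. by case: x y => [a b] [c d]. Qed.

Lemma cImM x y : complex.Im (x * y) =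
  complex.Re x * complex.Im y + complex.Im x * complex.Re y.
Proof. by case: x y => [a b] [c d]. Qed.

Lemma cRe_sum (I : Type) (r : seq I) (P : pred I) (F : I -> R[i]) :
  complex.Re (\sum_(i <- r | P i) F i) = \sum_(i <- r | P i) complex.Re (F i).
Proof. exact: (big_morph _ cReD). Qed.

Lemma cIm_sum (I : Type) (r : seq I) (P : pred I) (F : I -> R[i]) :
  complex.Im (\sum_(i <- r | P i) F i) = \sum_(i <- r | P i) complex.Im (F i).
Proof. exact: (big_morph _ cImD). Qed.

Lemma cRe_scale (c : R) x : complex.Re (real_complex R c * x) = c * complex.Re x.
Proof. by rewrite cReM mul0r subr0. Qed.

Lemma cIm_scale (c : R) x : complex.Im (real_complex R c * x) = c * complex.Im x.
Proof. by rewrite cImM mul0r addr0. Qed.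

Lemma natc (n : nat) : n%:R = real_complex R n%:R.
Proof. by rewrite rmorph_nat. Qed.

Lemma signc (s : bool) : (-1) ^+ s = real_complex R ((-1) ^+ s).
Proof. by rewrite rmorph_sign. Qed.

Lemma cRe_wedge k l (a : covec R R[i] k) (b : covec R R[i] l) v :
  complex.Re (wedge_covec a b v) =
  wedge_covec (fun w => complex.Re (a w)) (fun w => complex.Re (b w)) v -
  wedge_covec (fun w => complex.Im (a w)) (fun w => complex.Im (b w)) v.
Proof.
rewrite /wedge_covec natc -fmorphV cRe_scale cRe_sum -mulrBr -sumrB.
congr (_ * _); apply: eq_bigr => s _.
by rewrite signc -mulrA cRe_scale cReM mulrBr !mulrA.
Qed.

Lemma cIm_wedge k l (a : covec R R[i] k) (b : covec R R[i] l) v :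
  complex.Im (wedge_covec a b v) =
  wedge_covec (fun w => complex.Re (a w)) (fun w => complex.Im (b w)) v +
  wedge_covec (fun w => complex.Im (a w)) (fun w => complex.Re (b w)) v.
Proof.
rewrite /wedge_covec natc -fmorphV cIm_scale cIm_sum -mulrDr -big_split.
congr (_ * _); apply: eq_bigr => s _ /=.
by rewrite signc -mulrA cIm_scale cImM mulrDr !mulrA.
Qed.

Lemma wedge0l (K : fieldType) k l (b : covec R K l) v :
  wedge_covec ((fun=> 0) : covec R K k) b v = 0.
Proof. by rewrite /wedge_covec big1 ?mulr0 // => s _; rewrite mulr0 mul0r. Qed.

Lemma wedge0r (K : fieldType) k l (a : covec R K k) v :
  wedge_covec a ((fun=> 0) : covec R K l) v = 0.
Proof. by rewrite /wedge_covec big1 ?mulr0 // => s _; rewrite mulr0. Qed.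

End ComplexParts.

Lemma emon3E (K : comNzRingType) (X : Type) (th : nat -> X -> K) a b c (v : 'I_3 -> X) :
  let x := v ord0 in let y := v (lift ord0 ord0) in let z := v ord_max in
  emon th [:: a; b; c] v =
  th a x * (th b y * th c z - th c y * th b z)
  - th b x * (th a y * th c z - th c y * th a z)
  + th c x * (th a y * th b z - th b y * th a z).
Proof.
move=> x y z.
rewrite /emon eform_contract !big_ord_recl big_ord0.
have E i j : eform th (fun i0 : 'I_2 => nth 0%N [:: i; j] i0) (v \o lift ord0) =
    th i y * th j z - th j y * th i z.
  by rewrite -[LHS]/(emon th [:: i; j] _) emon2E /= (_ : lift ord0 ord_max = ord_max) //;
    apply: val_inj.
have cong s t : s =1 t -> eform th s (v \o lift ord0) = eform th t (v \o lift ord0).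
  by move=> st; congr eform; apply/funext.
pose S (j : 'I_3) (i : 'I_2) := nth 0%N [:: a; b; c] (lift j i).
rewrite (cong (S ord0) (fun i : 'I_2 => nth 0%N [:: b; c] i)) => [|[[|[|//]] ?]] //.
rewrite (cong (S (lift ord0 ord0)) (fun i : 'I_2 => nth 0%N [:: a; c] i))
  => [|[[|[|//]] ?]] //.
rewrite (cong (S (lift ord0 (lift ord0 ord0))) (fun i : 'I_2 => nth 0%N [:: a; b] i))
  => [|[[|[|//]] ?]] //.
rewrite !E /= /bump /= !addn0 expr0 expr1 mul1r mulN1r.
rewrite (_ : (-1) ^+ (1 + 1) = 1 :> K) ?mul1r ?addr0 ?mulNr; last by rewrite -signr_odd.
by rewrite addrA.
Qed.

Section ThreeForm.
Context {R : realType}.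
Local Notation V := (vec R).
Variables (xi : V) (Phi : V -> V) (eta : V -> R) (U : covec R R[i] 3).
Hypothesis ReM3 : multilinear (fun v => complex.Re (U v)).
Hypothesis ReA3 : Defs.alternating (fun v => complex.Re (U v)).
Hypothesis ImM3 : multilinear (fun v => complex.Im (U v)).
Hypothesis ImA3 : Defs.alternating (fun v => complex.Im (U v)).
Hypothesis U_xi : forall v, U (cons_vec xi v) = 0.
Hypothesis U_Phi : forall v : 'I_3 -> V, (forall i, eta (v i) = 0) ->
  forall i, U [eta v with i |-> Phi (v i)] = Complex 0 1 * U v.

Lemma U_perm v (s : 'S_3) : U (v \o s) = (-1) ^+ s * U v.
Proof.
rewrite signc; apply: complexP; rewrite ?cRe_scale ?cIm_scale.
  exact: (alternating_perm v s ReM3 ReA3).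
exact: (alternating_perm v s ImM3 ImA3).
Qed.

Lemma U_repeat v i j : i != j -> v i = v j -> U v = 0.
Proof.
by move=> ij vij; apply: complexP; [exact: (ReA3 ij)|exact: (ImA3 ij)].
Qed.

Lemma U_slot_xi v i : v i = xi -> U v = 0.
Proof.
move=> vi; have := U_xi ((v \o tperm ord0 i) \o lift ord0).
have <- : (v \o tperm ord0 i) ord0 = xi by rewrite /= tpermL.
by rewrite cons_vec_eta U_perm => /eqP; rewrite mulf_eq0 signr_eq0 => /eqP.
Qed.

(** [U_Phi] changes one slot at a time and needs horizontal arguments; as [Phi] preserves
    horizontality, it can be iterated over the slots. *)
Lemma U_Phis (b : 'I_3 -> bool) (w : 'I_3 -> V) : (forall i, eta (w i) = 0) ->
  (forall u, eta u = 0 -> eta (Phi u) = 0) ->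
  U (fun i => if b i then Phi (w i) else w i) =
  (\prod_i (if b i then Complex 0 1 else 1)) * U w.
Proof.
move=> w0 Phi0.
(* [s] lists the slots already treated; the induction is on this list. *)
pose w' (s : seq 'I_3) i := if (i \in s) && b i then Phi (w i) else w i.
have w'0 s i : eta (w' s i) = 0 by rewrite /w'; case: ifP => // _; exact: Phi0.
have key s : uniq s ->
    U (w' s) = (\prod_(i <- s) (if b i then Complex 0 1 else 1)) * U w.
  elim: s => [|i s IH] /=; first by rewrite big_nil mul1r.
  move=> /andP[i_s us].
  rewrite big_cons -mulrA -IH //.
  have [bi|bi] := boolP (b i).
    rewrite -(U_Phi (w'0 s) i); congr U; apply/funext => j.
    rewrite /w' /= inE; case: (j =P i) => [->|//].
    by rewrite (negbTE i_s) bi.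
  rewrite mul1r; congr U; apply/funext => j.
  rewrite /w' inE; case: (j =P i) => [->|//].
  by rewrite (negbTE bi) !andbF.
have := key (index_enum _) (index_enum_uniq _); rewrite -/(index_enum _) => <-.
by congr U; apply/funext => i; rewrite /w' mem_index_enum.
Qed.

Variable (u : 'I_3 -> V).
Hypothesis u0 : forall i, eta (u i) = 0.
Hypothesis eta_Phi : forall w, eta (Phi w) = 0.

(** The selection matrix is a permutation matrix if [c] is injective and has two equal rows
    otherwise, where [U] vanishes as well. *)
Lemma U_select (c : 'I_3 -> 'I_3) :
  U (u \o c) = \det (\matrix_(i, j) (c i == j)%:R) * U u.
Proof.
case: (boolP (injectiveb c)) => [cI|/injectivePn]; last first.
  case=> i [j ij cij]; rewrite (U_repeat ij) /= ?cij //.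
  rewrite (determinant_alternate ij) ?mul0r // => x.
  by rewrite !mxE cij.
pose s := perm (injectiveP _ cI).
rewrite (_ : u \o c = u \o s); last by apply/funext => i; rewrite /= permE.
rewrite U_perm -det_perm; congr (\det _ * _).
by apply/matrixP => i j; rewrite !mxE permE.
Qed.

(** Real index 2a+1 or 2a+2 belongs to the complex direction a (counted from 0), and [zeta] is the
    scalar 1 or i with which a (3,0)-form sees that vector. Index 0 falls into slot 0 by default,
    harmlessly since its [zeta] is 0. *)
Definition slot (m : 'I_7) : 'I_3 := inord (m.-1./2).
Definition zeta (m : 'I_7) : R[i] :=
  if m == ord0 then 0 else if odd m then 1 else Complex 0 1.
Definition cframe (m : 'I_7) : V :=
  if m == ord0 then xi else if odd m then u (slot m) else Phi (u (slot m)).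

Lemma U_cframe (p : 'I_3 -> 'I_7) :
  U (cframe \o p) = (\prod_i zeta (p i)) * U (u \o slot \o p).
Proof.
have [/existsP[i /eqP pi0]|/existsPn p0] := boolP [exists i, p i == ord0].
  rewrite (@U_slot_xi _ i) /= ?/cframe ?pi0 //.
  by rewrite (bigD1 i) //= /zeta pi0 eqxx !mul0r.
rewrite (_ : cframe \o p = fun i => if ~~ odd (p i) then Phi (u (slot (p i)))
    else u (slot (p i))); last first.
  apply/funext => i; rewrite /= /cframe (negbTE (p0 i)).
  by case: odd.
rewrite (@U_Phis (fun i => ~~ odd (p i)) (u \o slot \o p)) => [|i|//]; last first.
  exact: u0.
congr (_ * _); apply: eq_bigr => i _; rewrite /zeta (negbTE (p0 i)).
by case: odd.
Qed.

(** A (3,0)-form is a multiple of dz_1 /\ dz_2 /\ dz_3: entry (i, j) of the matrix is dz_j evaluated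
    at [v i]. *)
Lemma U_det (t : 'I_7 -> V -> R) :
  (forall v, v = \sum_m t m v *: cframe m) -> forall v,
  U v = \det (\matrix_(i, j) \sum_(m | slot m == j)
                real_complex R (t m (v i)) * zeta m) * U u.
Proof.
move=> tE v.
have -> : U v = \sum_(p : {ffun 'I_3 -> 'I_7})
    real_complex R (\prod_i t (p i) (v i)) * U (cframe \o p).
  have vE : v = fun i => \sum_m t m (v i) *: cframe m.
    by apply/funext => i; exact: tE.
  apply: complexP; rewrite ?cRe_sum ?cIm_sum {1}vE.
    under [RHS]eq_bigr do rewrite cRe_scale.
    exact: (multilinear_expand (fun i m => t m (v i)) cframe ReM3).
  under [RHS]eq_bigr do rewrite cIm_scale.
  exact: (multilinear_expand (fun i m => t m (v i)) cframe ImM3).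
under eq_bigr => p _ do rewrite U_cframe -compA U_select !mulrA.
rewrite -mulr_suml; congr (_ * _).
under eq_bigr do rewrite mulr_sumr.
rewrite exchange_big; apply: eq_bigr => s _ /=.
under [X in _ = _ * X]eq_bigr do rewrite mxE big_mkcond.
rewrite bigA_distr_bigA mulr_sumr; apply: eq_bigr => p _ /=.
rewrite mulrCA; congr (_ * _); rewrite rmorph_prod -big_split -big_split /=.
apply: eq_bigr => i _; rewrite mxE /=.
by case: eqP => _; rewrite ?mulr1 ?mulr0.
Qed.

End ThreeForm.

(** * Frames adapted to a transverse Calabi-Yau structure *)

Section AdaptedFrame.
Context {R : realType}.
Local Notation V := (vec R).
Variables (g : V -> V -> R) (xi : V) (Phi : V -> V) (eta : V -> R).
Hypothesis gL : forall w a u v, g (a *: u + v) w = a * g u w + g v w.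
Hypothesis gC : forall u v, g u v = g v u.
Hypothesis g_gt0 : forall u, u != 0 -> 0 < g u u.
Hypothesis PhiL : forall a u v, Phi (a *: u + v) = a *: Phi u + Phi v.
Hypothesis etaL : forall a u v, eta (a *: u + v) = a * eta u + eta v.
Hypothesis eta_xi : eta xi = 1.
Hypothesis g_Phi_xi : forall u, g (Phi xi) u = 0.
Hypothesis Phi2 : forall u, Phi (Phi u) = - u + eta u *: xi.
Hypothesis g_Phi : forall u v, g (Phi u) (Phi v) = g u v - eta u * eta v.

Let g0l w : g 0 w = 0.
Proof.
by have := gL w 1 0 0; rewrite scale1r addr0 mul1r => /eqP;
  rewrite -subr_eq subrr eq_sym => /eqP.
Qed.
Let gD u v w : g (u + v) w = g u w + g v w.
Proof. by rewrite -[u]scale1r gL mul1r scale1r. Qed.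
Let gZ a u w : g (a *: u) w = a * g u w.
Proof. by rewrite -[a *: u]addr0 gL g0l addr0. Qed.
Let gN u w : g (- u) w = - g u w.
Proof. by rewrite -scaleN1r gZ mulN1r. Qed.
Let gDr u v w : g w (u + v) = g w u + g w v.
Proof. by rewrite gC gD !(gC _ w). Qed.
Let gZr a u w : g w (a *: u) = a * g w u.
Proof. by rewrite gC gZ gC. Qed.
Let gNr u w : g w (- u) = - g w u.
Proof. by rewrite gC gN gC. Qed.
Let Phi0 : Phi 0 = 0.
Proof.
by have := PhiL 1 0 0; rewrite !scale1r addr0 => /eqP;
  rewrite -subr_eq subrr eq_sym => /eqP.
Qed.
Let PhiD u v : Phi (u + v) = Phi u + Phi v.
Proof. by rewrite -[u]scale1r PhiL !scale1r. Qed.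
Let PhiZ a u : Phi (a *: u) = a *: Phi u.
Proof. by rewrite -[a *: u]addr0 PhiL Phi0 addr0. Qed.
Let PhiN u : Phi (- u) = - Phi u.
Proof. by rewrite -scaleN1r PhiZ scaleN1r. Qed.

Let Phi_xi : Phi xi = 0.
Proof.
apply/eqP/negP => /negP /g_gt0.
by rewrite g_Phi_xi ltxx.
Qed.

Let g_xi v : g xi v = eta v.
Proof.
have := g_Phi xi v; rewrite Phi_xi g0l eta_xi mul1r => /esym/eqP.
by rewrite subr_eq0 => /eqP.
Qed.

(** Computing Phi^3 u in two ways leaves eta(Phi u) xi = 0. *)
Let eta_Phi u : eta (Phi u) = 0.
Proof.
have := congr1 Phi (Phi2 u); rewrite Phi2 PhiD PhiZ Phi_xi scaler0 PhiN.
move/addrI/eqP; rewrite scaler_eq0 => /orP[/eqP //|/eqP x0].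
by have := eta_xi; rewrite -g_xi x0 g0l => /eqP; rewrite eq_sym oner_eq0.
Qed.

Let g_Phi_skew u v : g (Phi u) v = - g u (Phi v).
Proof.
have := g_Phi u (Phi v); rewrite Phi2 eta_Phi mulr0 subr0 gDr gNr gZr => <-.
by rewrite (gC _ xi) g_xi eta_Phi mulr0 addr0 opprK.
Qed.

Let g_Phi_diag u : g (Phi u) u = 0.
Proof. by have := g_Phi_skew u u; rewrite (gC u) => ?; lra. Qed.

(** A dimension count: fewer than 7 linear equations in R^7 have a nonzero solution, which is then
    scaled to unit length. *)
Lemma exists_orthogonal_unit (s : seq V) : (size s < 7)%N ->
  exists2 u, g u u = 1 & forall w, w \in s -> g u w = 0.
Proof.
move=> s7; pose G := \matrix_(p < 7, j < size s) g (basis_vec p) (nth 0 s j).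
have GE (u : V) j : (u *m G) 0 j = g u (nth 0 s j).
  rewrite mxE {2}(coord_expand u).
  elim/big_rec2: _ => [|m x y _ ->]; first by rewrite g0l.
  by rewrite gL mxE.
have : kermx G != 0.
  rewrite -mxrank_eq0 mxrank_ker -lt0n subn_gt0.
  exact: leq_ltn_trans (rank_leq_col _) _.
case/rowV0Pn => u /sub_kermxP uG u0.
have gu := g_gt0 u0.
exists ((Num.sqrt (g u u))^-1 *: u).
  rewrite gZ gZr mulrA -invfM -expr2 sqr_sqrtr ?mulVf ?gt_eqF //.
  exact: ltW.
move=> w ws; rewrite gZ; have := GE u; rewrite uG.
have iw : (index w s < size s)%N by rewrite index_mem.
by move=> /(_ (Ordinal iw)); rewrite mxE /= nth_index // => <-; rewrite mulr0.
Qed.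

Definition unitary_triple (u1 u2 u3 : V) :=
  [/\ [/\ eta u1 = 0, eta u2 = 0 & eta u3 = 0],
      [/\ g u1 u1 = 1, g u2 u2 = 1 & g u3 u3 = 1],
      [/\ g u1 u2 = 0, g u1 u3 = 0 & g u2 u3 = 0] &
      [/\ g (Phi u1) u2 = 0, g (Phi u1) u3 = 0 & g (Phi u2) u3 = 0]].

(** Each vector is orthogonal to [xi], hence horizontal, and to the complex lines already chosen;
    these are 1, 3 and 5 conditions in dimension 7. *)
Lemma unitary_triple_exists : exists u1 u2 u3, unitary_triple u1 u2 u3.
Proof.
have [u1 g11 h1] := @exists_orthogonal_unit [:: xi] isT.
have [u2 g22 h2] := @exists_orthogonal_unit [:: xi; u1; Phi u1] isT.
have [u3 g33 h3] := @exists_orthogonal_unit [:: xi; u1; Phi u1; u2; Phi u2] isT.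
exists u1, u2, u3; split; split => //; rewrite -?g_xi 1?gC.
all: by (apply: h1 || apply: h2 || apply: h3); rewrite !inE eqxx ?orbT.
Qed.

(** The new vector is (a - i b) u3 for the complex structure [Phi], with a - i b of modulus 1. *)
Lemma unitary_triple_rotate u1 u2 u3 a b :
  a ^+ 2 + b ^+ 2 = 1 -> unitary_triple u1 u2 u3 ->
  unitary_triple u1 u2 (a *: u3 - b *: Phi u3).
Proof.
move=> ab [[e1 e2 e3] [g1 g2 g3] [g12 g13 g23] [p12 p13 p23]].
split; split => //.
- by rewrite etaL e3 mulr0 add0r -scaleNr -[X in eta X]addr0 etaL eta_Phi mulr0
    -(g_xi 0) gC g0l addr0.
- rewrite !(gD, gDr, gN, gNr, gZ, gZr) g_Phi (gC u3 (Phi u3)) g_Phi_diag g3 e3.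
  by move: ab => ?; lra.
- by rewrite !(gDr, gNr, gZr) g13 (gC u1) g_Phi_skew (gC u3) p13; ring.
- by rewrite !(gDr, gNr, gZr) g23 (gC u2) g_Phi_skew (gC u3) p23; ring.
- by rewrite !(gDr, gNr, gZr) p13 g_Phi e1 g13; ring.
- by rewrite !(gDr, gNr, gZr) p23 g_Phi e2 g23; ring.
Qed.

Definition triple_frame (u1 u2 u3 : V) (n : nat) : V :=
  nth 0 [:: xi; u1; Phi u1; u2; Phi u2; u3; Phi u3] n.

Lemma triple_frame_orthonormal u1 u2 u3 (i j : 'I_7) : unitary_triple u1 u2 u3 ->
  g (triple_frame u1 u2 u3 i) (triple_frame u1 u2 u3 j) = (i == j)%:R.
Proof.
move=> [[e1 e2 e3] [g1 g2 g3] [g12 g13 g23] [p12 p13 p23]].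
have p21 : g (Phi u2) u1 = 0 by rewrite g_Phi_skew gC p12 oppr0.
have p31 : g (Phi u3) u1 = 0 by rewrite g_Phi_skew gC p13 oppr0.
have p32 : g (Phi u3) u2 = 0 by rewrite g_Phi_skew gC p23 oppr0.
have sym (m n : 'I_7) : (m <= n)%N ->
  g (triple_frame u1 u2 u3 m) (triple_frame u1 u2 u3 n) = (m == n)%:R.
  rewrite -val_eqE; case: m n => [m m7] [n n7] /=.
  do 7?[case: m m7 => [|m] m7 //]; do 7?[case: n n7 => [|n] n7 //] => _;
    rewrite /triple_frame /= ?g_Phi ?g_Phi_diag ?g_xi ?eta_xi ?eta_Phi
      ?e1 ?e2 ?e3 ?g1 ?g2 ?g3 ?g12 ?g13 ?g23 ?p12 ?p13 ?p23 ?mulr0 ?subr0 //;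
    by rewrite ?(gC _ (Phi _)) ?g_Phi_diag ?p12 ?p13 ?p23 ?p21 ?p31 ?p32.
case/orP: (leq_total i j) => ij; first exact: sym.
by rewrite gC eq_sym; exact: sym.
Qed.

(** Column j is the [g]-dual of the j-th frame vector. Scaling the contact column by [lam] makes the
    coframe orthonormal for lam^2 eta^2 + g_D instead of [g]. *)
Definition triple_matrix (lam : R) (u1 u2 u3 : V) : 'M[R]_7 :=
  \matrix_(p, j) ((if j == ord0 then lam else 1) *
                  g (basis_vec p) (triple_frame u1 u2 u3 j)).

Section Triple.
Variables (lam : R) (u1 u2 u3 : V).
Hypothesis lam_gt0 : 0 < lam.
Hypothesis uT : unitary_triple u1 u2 u3.
Local Notation F := (triple_frame u1 u2 u3).
Local Notation A := (triple_matrix lam u1 u2 u3).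
Local Notation th := (coframe A).

Lemma triple_coframe (j : 'I_7) v : th j v = (if j == ord0 then lam else 1) * g v (F j).
Proof.
rewrite coframe_ord mxE {2}(coord_expand v).
elim/big_rec2: _ => [|m x y _ ->]; first by rewrite g0l mulr0.
by rewrite gL mxE /ccoord [RHS]mulrDr mulrCA.
Qed.

Lemma triple_matrix_unit : A \in unitmx.
Proof.
pose B : 'M[R]_7 := \matrix_i ((if i == ord0 then lam^-1 else 1) *: F i).
suff BA : B *m A = 1%:M by have [] := mulmx1_unit BA.
apply/row_matrixP => i; rewrite row_mul [row i B]rowK; apply/rowP => j.
rewrite -coframe_ord triple_coframe gZ triple_frame_orthonormal // row1 !mxE eqxx /=.
have [->|ij] := eqVneq i j; last by rewrite !mulr0.
by case: ifP => _; rewrite ?mulr1 // mulfV // gt_eqF.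
Qed.

Lemma triple_frameE (j : 'I_7) :
  frame A j = (if j == ord0 then lam^-1 else 1) *: F j.
Proof.
rewrite [RHS](coframe_expand triple_matrix_unit) (bigD1 j) //=.
rewrite big1 ?addr0 => [|m /negbTE mj].
  rewrite triple_coframe gZ triple_frame_orthonormal // eqxx mulr1.
  by case: ifP => _; rewrite ?mulfV ?mulr1 ?scale1r // gt_eqF.
rewrite triple_coframe gZ triple_frame_orthonormal // [j == m]eq_sym mj.
by rewrite !mulr0 scale0r.
Qed.

Lemma triple_coframe0 v : th 0%N v = lam * eta v.
Proof. by rewrite (triple_coframe ord0) eqxx gC g_xi. Qed.

Lemma triple_coframeS (m : 'I_6) v : th m.+1 v = g (F m.+1) v.
Proof. by rewrite (triple_coframe (lift ord0 m)) /= mul1r gC. Qed.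

Let g_expand u w : g u w = eta u * eta w + \sum_(m < 6) th m.+1 u * g (F m.+1) w.
Proof.
rewrite {1}(coframe_expand triple_matrix_unit u) big_ord_recl.
rewrite gD gZ triple_coframe0 triple_frameE eqxx gZ g_xi.
congr (_ + _); first by rewrite mulrACA mulfV ?mul1r ?gt_eqF.
elim/big_rec2: _ => [|m x y _ <-]; first by rewrite g0l.
by rewrite gL triple_frameE /= scale1r /bump leq0n add1n.
Qed.

Lemma triple_metric u w : \sum_(m < 7) th m u * th m w =
  lam ^+ 2 * (eta u * eta w) + (g u w - eta u * eta w).
Proof.
rewrite big_ord_recl /= !triple_coframe0 g_expand addrAC subrr add0r.
congr (_ + _); first by rewrite expr2 mulrACA.
by apply: eq_bigr => m _; rewrite -triple_coframeS /bump leq0n add1n.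
Qed.

(** The result is free of [lam] because eta(Phi w) = 0 removes the contact component. *)
Lemma triple_omega (v : 'I_2 -> V) :
  g (Phi (v ord0)) (v ord_max) = ieval th iomega v.
Proof.
have T (m : nat) (w : V) : (m < 6)%N -> g (F m.+1) w = th m.+1 w.
  by move=> m6; rewrite (triple_coframeS (Ordinal m6)).
have T1 w := T 0%N w isT; have T2 w := T 1%N w isT; have T3 w := T 2%N w isT.
have T4 w := T 3%N w isT; have T5 w := T 4%N w isT; have T6 w := T 5%N w isT.
rewrite /triple_frame /= in T1 T2 T3 T4 T5 T6.
have G u w : g u (Phi w) = - g (Phi u) w by rewrite g_Phi_skew opprK.
have [[e1 e2 e3] _ _ _] := uT.
rewrite g_Phi_skew g_expand eta_Phi mulr0 add0r.
rewrite !big_ord_recl big_ord0 /= /triple_frame /= !g_Phi e1 e2 e3 !G.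
rewrite !(T1, T2, T3, T4, T5, T6) /bump /=.
rewrite /ieval /iomega !big_cons big_nil /= !emon2E mulr1z.
ring.
Qed.

End Triple.


(** * The holomorphic volume form in a unitary frame, and its phase *)

Section ThreeFormTriple.
Variable U : covec R R[i] 3.
Hypothesis ReM3 : multilinear (fun v => complex.Re (U v)).
Hypothesis ReA3 : Defs.alternating (fun v => complex.Re (U v)).
Hypothesis ImM3 : multilinear (fun v => complex.Im (U v)).
Hypothesis ImA3 : Defs.alternating (fun v => complex.Im (U v)).
Hypothesis U_xi : forall v, U (cons_vec xi v) = 0.
Hypothesis U_Phi : forall v : 'I_3 -> V, (forall i, eta (v i) = 0) ->
  forall i, U [eta v with i |-> Phi (v i)] = Complex 0 1 * U v.

Definition triple_fun (u1 u2 u3 : V) (i : 'I_3) : V := nth 0 [:: u1; u2; u3] i.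

(** [U_det] for the unitary frame, with the complex determinant expanded into real and imaginary
    parts. *)
Lemma triple_three_form lam u1 u2 u3 v : 0 < lam -> unitary_triple u1 u2 u3 ->
  let A := triple_matrix lam u1 u2 u3 in
  U v = Complex (ieval (coframe A) ire v) (ieval (coframe A) iim v) *
        U (triple_fun u1 u2 u3).
Proof.
move=> lam0 uT A; pose F := triple_frame u1 u2 u3.
have u0 i : eta (triple_fun u1 u2 u3 i) = 0.
  have [[e1 e2 e3] _ _ _] := uT.
  by case: i => [[|[|[|//]]] ?].
have slotE (m : 'I_7) (j : 'I_3) : (slot m == j) = (m.-1./2 == j).
  rewrite -val_eqE /= inordK //.
  by case: m => [[|[|[|[|[|[|[|//]]]]]]] ?].
have cframeE m : cframe xi Phi (triple_fun u1 u2 u3) m = F m.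
  rewrite /cframe /F /triple_frame /triple_fun /slot -val_eqE.
  by case: m => [[|[|[|[|[|[|[|//]]]]]]] ?] //=; rewrite inordK.
(* Expanded with lam = 1: only the contact component depends on [lam], and [zeta] annihilates it. *)
have expand w : w = \sum_(m < 7) g w (F m) *: cframe xi Phi (triple_fun u1 u2 u3) m.
  rewrite {1}(coframe_expand (triple_matrix_unit ltr01 uT) w); apply: eq_bigr => m _.
  rewrite triple_coframe triple_frameE // cframeE invr1.
  by case: ifP => _; rewrite mul1r scale1r.
rewrite (U_det ReM3 ReA3 ImM3 ImA3 U_xi U_Phi u0 eta_Phi expand).
congr (_ * _).
have T (m : nat) (w : V) : (m < 6)%N -> g w (F m.+1) = coframe A m.+1 w.
  by move=> m6; rewrite (triple_coframeS lam u1 u2 u3 (Ordinal m6)) gC.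
(* [Z n] is the complex covector e^(2n+1) + i e^(2n+2). *)
pose Z n w := Complex (coframe A n.*2.+1 w) (coframe A n.*2.+2 w).
transitivity (emon Z [:: 0; 1; 2]%N v).
  congr (\det _); apply/matrixP => i j; rewrite !mxE.
  under eq_bigl do rewrite slotE.
  rewrite big_mkcond !big_ord_recl big_ord0 /= /zeta /= /bump /=.
  case: j => [[|[|[|//]]] ?] /=; rewrite ?mulr0 ?add0r ?addr0 mulr1 /Z;
    apply: complexP; rewrite !(cReD, cImD, cReM, cImM) /=;
    by rewrite ?mul0r ?mulr0 ?mulr1 ?subr0 ?addr0 ?add0r -T.
rewrite emon3E; apply: complexP;
  rewrite /Z !(cReD, cImD, cReN, cImN, cReM, cImM) /= /ieval /ire /iim !big_cons big_nil /=
          !emon3E !mulr1z ?mulrN1z; ring.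
Qed.

Hypothesis U_vol : forall v : 'I_6 -> V,
  let w : covec R R[i] 2 := fun v => real_complex R (g (Phi (v ord0)) (v ord_max)) in
  (3`!)%:R^-1 * wedge_covec (wedge_covec w w) w v =
  Complex 0 1 / 8%:R * wedge_covec U (fun v => conjc (U v)) v.

(** The volume identity is evaluated on the six horizontal frame vectors: omega^3 / 3! gives 1, and
    (i/8) U /\ conj U gives |z|^2. *)
Lemma triple_norm u1 u2 u3 : unitary_triple u1 u2 u3 ->
  let z := U (triple_fun u1 u2 u3) in complex.Re z ^+ 2 + complex.Im z ^+ 2 = 1.
Proof.
move=> uT z; pose A := triple_matrix 1 u1 u2 u3.
have uA : A \in unitmx := triple_matrix_unit ltr01 uT.
pose v (i : 'I_6) := frame A i.+1.
pose e := emon (coframe A) (iota 1 6) v.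
have e1 : e = 1.
  rewrite /e /emon /eform -[RHS](det1 R 6); congr (\det _).
  apply/matrixP => i j; rewrite !mxE coframe_frame //; last by rewrite ltnS.
  by rewrite nth_iota // add1n eqSS eq_sym.
pose w : covec R R 2 := ieval (coframe A) iomega.
have wE : (fun v : 'I_2 -> V => real_complex R (g (Phi (v ord0)) (v ord_max))) =
    (fun v => real_complex R (w v)).
  by apply/funext => x; rewrite (triple_omega ltr01 uT).
pose P (a b : R) : covec R R 3 := fun x =>
  \sum_(c <- [:: (a, ire); (b, iim)]) c.1 * ieval (coframe A) c.2 x.
have PE a b x : P a b x = a * ieval (coframe A) ire x + b * ieval (coframe A) iim x.
  by rewrite /P !big_cons big_nil /= addr0.
(* The wedge squares of [ire] and [iim] vanish and [ire] /\ [iim] is 4 times the horizontal volume,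
   with the opposite sign in the other order. *)
have P_wedge a b c d : wedge_covec (P a b) (P c d) v = 4%:R * (a * d - b * c).
  have ev p n : ieq 6 p [:: (n, iota 1 6)] -> ieval (coframe A) p v = n%:~R.
    by move/ieval_eq ->; rewrite /ieval big_seq1 /= -/e e1 mulr1.
  rewrite /P wedge_covec_suml !big_cons big_nil /= !wedge_covec_sumr !big_cons !big_nil /=.
  rewrite !ieval_wedge // (ev (iwedge ire ire) 0) ?(ev (iwedge ire iim) 4)
    ?(ev (iwedge iim ire) (- 4)) ?(ev (iwedge iim iim) 0); try by vm_compute.
  rewrite -[(4 : int)%:~R]/(4%:R : R) intrN -[(4 : int)%:~R]/(4%:R : R); ring.
have omega3 : wedge_covec (wedge_covec w w) w v = 6%:R.
  rewrite (_ : wedge_covec w w = ieval (coframe A) (iwedge iomega iomega)); last first.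
    by apply/funext => x; rewrite ieval_wedge.
  rewrite ieval_wedge // (@ieval_eq _ _ _ 6 _ _ [:: (6, iota 1 6)]); last by vm_compute.
  by rewrite /ieval big_seq1 /= -/e e1 mulr1.
have cReU : (fun x => complex.Re (U x)) = P (complex.Re z) (- complex.Im z).
  apply/funext => x; rewrite PE (triple_three_form x ltr01 uT) cReM /= -/z -/A.
  ring.
have cImU : (fun x => complex.Im (U x)) = P (complex.Im z) (complex.Re z).
  apply/funext => x; rewrite PE (triple_three_form x ltr01 uT) cImM /= -/z -/A.
  ring.
have cReUc : (fun x => complex.Re (conjc (U x))) = P (complex.Re z) (- complex.Im z).
  by rewrite -cReU; apply/funext => x; case: (U x).
have cImUc : (fun x => complex.Im (conjc (U x))) = P (- complex.Im z) (- complex.Re z).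
  apply/funext => x; transitivity (- complex.Im (U x)); first by case: (U x).
  have -> := congr1 (fun f => f x) cImU.
  by rewrite !PE; ring.
(* The factor i/8 turns the imaginary part of U /\ conj U, equal to -8 |z|^2, into a real part. *)
have := congr1 (@complex.Re R) (U_vol v); rewrite /= wE.
have -> : Complex 0 1 / 8%:R = Complex 0 8%:R^-1 :> R[i].
  by rewrite natc -fmorphV; apply: complexP; rewrite ?(cReM, cImM) /=; ring.
rewrite natc -fmorphV cRe_scale cRe_wedge [in RHS]cReM cIm_wedge /= mul0r sub0r.
have ReW : (fun x => complex.Re (wedge_covec (fun y => real_complex R (w y))
    (fun y => real_complex R (w y)) x)) = wedge_covec w w.
  by apply/funext => x; rewrite cRe_wedge /= wedge0l subr0.
have ImW : (fun x => complex.Im (wedge_covec (fun y => real_complex R (w y))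
    (fun y => real_complex R (w y)) x)) = fun=> 0.
  by apply/funext => x; rewrite cIm_wedge /= wedge0l wedge0r addr0.
rewrite ReW ImW wedge0l subr0.
rewrite cReU cImU cReUc cImUc !P_wedge [X in _ * X = _]omega3.
have -> : (3`!)%:R = 6%:R :> R by [].
rewrite mulVf ?pnatr_eq0 // => ?.
have : 8%:R^-1 * (4%:R * (complex.Re z ^+ 2 + complex.Im z ^+ 2) * 2%:R) = 1 :> R by lra.
move=> ?; lra.
Qed.

(** Replacing u3 by conj(z) u3 multiplies the value z by conj(z), and |z| = 1. *)
Lemma triple_adapted : exists u1 u2 u3,
  unitary_triple u1 u2 u3 /\ U (triple_fun u1 u2 u3) = 1.
Proof.
have [u1 [u2 [u3 uT]]] := unitary_triple_exists.
set z := U (triple_fun u1 u2 u3); have z1 : complex.Re z ^+ 2 + complex.Im z ^+ 2 = 1.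
  exact: triple_norm.
exists u1, u2, (complex.Re z *: u3 - complex.Im z *: Phi u3).
split; first exact: unitary_triple_rotate.
have tE w : triple_fun u1 u2 w = [eta triple_fun u1 u2 u3 with ord_max |-> w].
  by apply/funext => -[[|[|[|//]]] ?].
have UPhi : U (triple_fun u1 u2 (Phi u3)) = Complex 0 1 * z.
  rewrite tE -(U_Phi _ ord_max) // => i.
  by have [[e1 e2 e3] _ _ _] := uT; case: i => [[|[|[|//]]] ?].
have lin (f : covec R R 3) a b : multilinear f ->
    f (triple_fun u1 u2 (a *: u3 - b *: Phi u3)) =
    a * f (triple_fun u1 u2 u3) - b * f (triple_fun u1 u2 (Phi u3)).
  move=> fM; rewrite tE fM -!tE -scaleNr -[- b *: _]addr0 (tE (- b *: _ + 0)) fM -!tE.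
  have := fM (triple_fun u1 u2 u3) ord_max 1 0 0; rewrite scale1r addr0 mul1r -!tE.
  by move=> ?; lra.
apply: complexP => /=.
  rewrite (lin _ _ _ ReM3) UPhi -/z cReM /=; lra.
rewrite (lin _ _ _ ImM3) UPhi -/z cImM /=; lra.
Qed.

Lemma adapted_coframe lam : 0 < lam -> exists2 A : 'M[R]_7, A \in unitmx &
  [/\ forall v, coframe A 0%N v = lam * eta v,
      forall u w, \sum_(m < 7) coframe A m u * coframe A m w =
        lam ^+ 2 * (eta u * eta w) + (g u w - eta u * eta w),
      forall v : 'I_2 -> V, g (Phi (v ord0)) (v ord_max) = ieval (coframe A) iomega v,
      forall v, complex.Re (U v) = ieval (coframe A) ire v &
      forall v, complex.Im (U v) = ieval (coframe A) iim v].
Proof.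
move=> lam0; have [u1 [u2 [u3 [uT U1]]]] := triple_adapted.
exists (triple_matrix lam u1 u2 u3); first exact: triple_matrix_unit.
split=> [v|u w|v|v|v].
- exact: triple_coframe0.
- exact: triple_metric.
- exact: triple_omega.
- by rewrite (triple_three_form v lam0 uT) U1 mulr1.
- by rewrite (triple_three_form v lam0 uT) U1 mulr1.
Qed.

End ThreeFormTriple.

End AdaptedFrame.

(** * Smooth functions and symmetry of second derivatives *)

Lemma near_eq_differentiable {R : realType} {V W : normedModType R} (f g : V -> W) x :
  (\forall y \near x, f y = g y) -> differentiable f x -> differentiable g x.
Proof.
move=> fg /diff_locallyP[dfC dfE].
have gE : g \o shift x = cst (g x) + 'd f x +o_ 0 id.
  apply/eqaddoP => e e0; have /eqaddoP/(_ e e0) := dfE.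
  have fg0 : \forall h \near 0, f (h + x) = g (h + x).
    by move: fg; rewrite (near_shift 0) subr0.
  have fgx := nbhs_singleton fg.
  by apply: filterS2 fg0 => h /= fgh; rewrite /= !fctE /= fgh fgx.
have dgE : 'd g x = 'd f x :> (V -> W) := diff_unique dfC gE.
by apply/diff_locallyP; rewrite dgE.
Unshelve. all: by end_near. Qed.

Section SmoothOn.
Context {R : realType} {V : normedModType R}.
Variable U : set V.
Hypothesis openU : open U.

Lemma near_open (x : V) : U x -> \forall y \near x, U y.
Proof. by move=> Ux; exact: open_nbhs_nbhs. Qed.

(** On an open set, agreement is agreement of germs, so all iterated derivatives coincide there. *)
Lemma Ck_on_eq (W : normedModType R) k (f g : V -> W) :
  (forall x, U x -> f x = g x) -> Ck_on k U f -> Ck_on k U g.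
Proof.
have near_eq (h h' : V -> W) x : (forall y, U y -> h y = h' y) -> U x ->
    \forall y \near x, h y = h' y.
  by move=> hh' Ux; near=> y; apply: hh'; near: y; exact: near_open.
elim: k f g => [|k IH] f g fg /=.
  move=> fC x Ux; have := fC x Ux; rewrite /prop_for /continuous_at (fg x Ux).
  by apply: cvg_trans; apply: near_eq_cvg; exact: near_eq.
move=> [fd fC]; split=> [x Ux|v].
  by apply: near_eq_differentiable (fd x Ux); exact: near_eq.
by apply: IH (fC v) => x Ux; apply: near_eq_derive; exact: near_eq.
Unshelve. all: by end_near. Qed.

Lemma Ck_onS (W : normedModType R) k (f : V -> W) : Ck_on k.+1 U f -> Ck_on k U f.
Proof.
elim: k f => [|k IH] f /= [fd fC].
  by move=> x Ux; apply: differentiable_continuous; exact: fd.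
by split=> // v; apply: IH.
Qed.

Lemma Ck_on_cst (W : normedModType R) k (a : W) : Ck_on k U (fun=> a).
Proof.
elim: k a => [|k IH] a /=; first by move=> x _; exact: cst_continuous.
split=> [x _|v]; first exact: differentiable_cst.
have -> : (fun x => 'D_v (fun=> a) x) = (fun=> 0) :> (V -> W).
  by apply/funext => x; exact: derive_cst.
exact: IH.
Qed.

Lemma Ck_onD (W : normedModType R) k (f g : V -> W) :
  Ck_on k U f -> Ck_on k U g -> Ck_on k U (fun x => f x + g x).
Proof.
elim: k f g => [|k IH] f g /=.
  by move=> fC gC x Ux; apply: continuousD; [exact: fC|exact: gC].
move=> [fd fC] [gd gC]; split=> [x Ux|v].
  by apply: differentiableD; [exact: fd|exact: gd].
apply: (Ck_on_eq _ (IH _ _ (fC v) (gC v))) => x Ux.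
by rewrite (@deriveD _ _ _ f g) //; apply: diff_derivable; [exact: fd|exact: gd].
Qed.

Lemma Ck_onM k (f g : V -> R^o) :
  Ck_on k U f -> Ck_on k U g -> Ck_on k U (fun x => f x * g x : R^o).
Proof.
elim: k f g => [|k IH] f g.
  by move=> fC gC x Ux; apply: continuousM; [exact: fC|exact: gC].
move=> fk gk; have := fk; have := gk => /= -[gd gC] [fd fC]; split=> [x Ux|v].
  by apply: differentiableM; [exact: fd|exact: gd].
apply: (Ck_on_eq (f := fun x => f x * 'D_v g x + g x * 'D_v f x)) => [x Ux|].
  by rewrite (@deriveM _ _ f g) //; apply: diff_derivable; [exact: fd|exact: gd].
by apply: Ck_onD; apply: IH => //; exact: Ck_onS.
Qed.

Lemma smooth_on_cst (W : normedModType R) (a : W) : smooth_on U (fun=> a).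
Proof. by move=> k; exact: Ck_on_cst. Qed.

Lemma smooth_onD (W : normedModType R) (f g : V -> W) :
  smooth_on U f -> smooth_on U g -> smooth_on U (fun x => f x + g x).
Proof. by move=> fS gS k; exact: Ck_onD. Qed.

Lemma smooth_onM (f g : V -> R^o) :
  smooth_on U f -> smooth_on U g -> smooth_on U (fun x => f x * g x : R^o).
Proof. by move=> fS gS k; exact: Ck_onM. Qed.

Lemma smooth_onZ (c : R) (f : V -> R^o) :
  smooth_on U f -> smooth_on U (fun x => c * f x : R^o).
Proof. by move=> fS; apply: smooth_onM => //; exact: smooth_on_cst. Qed.

Lemma smooth_on_sum (I : Type) (r : seq I) (f : I -> V -> R^o) :
  (forall i, smooth_on U (f i)) -> smooth_on U (fun x => \sum_(i <- r) f i x : R^o).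
Proof.
move=> fS; elim: r => [|i r IH].
  have -> : (fun x => \sum_(i <- [::]) f i x) = (fun=> 0) :> (V -> R^o).
    by apply/funext => x; rewrite big_nil.
  exact: smooth_on_cst.
have -> : (fun x => \sum_(j <- i :: r) f j x) =
    (fun x => f i x + \sum_(j <- r) f j x) :> (V -> R^o).
  by apply/funext => x; rewrite big_cons.
exact: smooth_onD.
Qed.

Lemma smooth_on_derive (W : normedModType R) (f : V -> W) v :
  smooth_on U f -> smooth_on U (fun x => 'D_v f x).
Proof. by move=> fS k; have [_] := fS k.+1; apply. Qed.

Lemma smooth_on_differentiable (W : normedModType R) (f : V -> W) x :
  smooth_on U f -> U x -> differentiable f x.
Proof. by move=> fS Ux; have [+ _] := fS 1%N; apply. Qed.

End SmoothOn.

(** * Symmetry of second derivatives *)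

Section Schwarz.
Context {R : realType} {V : normedModType R}.

Lemma is_derive_line (f : V -> R^o) (y u : V) (s : R) :
  derivable f (y + s *: u) u ->
  is_derive s (1 : R) (fun s => f (y + s *: u) : R^o) ('D_u f (y + s *: u)).
Proof.
move=> df.
have E : (fun h : R => h^-1 *: (f (y + (h *: 1 + s) *: u) - f (y + s *: u))) =
    (fun h => h^-1 *: (f (h *: u + (y + s *: u)) - f (y + s *: u))).
  apply/funext => h; congr (_ *: (f _ - _)).
  by rewrite scalerDl addrCA [h *: 1]mulr1.
split; first by move: df; rewrite /derivable /= E.
by rewrite /derive /= E.
Qed.

Lemma MVT_from0 (f df : R -> R) (h : R) : 0 < h ->
  (forall s, 0 <= s <= h -> is_derive s (1 : R) f (df s)) ->
  exists2 s, 0 <= s <= h & f h - f 0 = df s * h.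
Proof.
move=> h0 fdf; have [ | |s] := @MVT R f df 0 h h0.
- move=> s; rewrite in_itv /= => /andP[s0 sh].
  by apply: fdf; rewrite !ltW.
- apply: derivable_within_continuous => s; rewrite in_itv /= => sh.
  by have [] := fdf s sh.
- rewrite in_itv /= => /andP[s0 sh]; rewrite subr0 => ->; exists s => //.
  by rewrite !ltW.
Qed.

(** The mean value theorem along [u], applied to the difference of [f] between two parallel lines,
    then along [v], applied to 'D_u f. *)
Lemma second_difference (f : V -> R^o) (x u v : V) (h : R) : 0 < h ->
  (forall s t, 0 <= s <= h -> 0 <= t <= h ->
    derivable f (x + s *: u + t *: v) u /\
    derivable ('D_u f) (x + s *: u + t *: v) v) ->
  exists s t, [/\ 0 <= s <= h, 0 <= t <= h &
    f (x + h *: u + h *: v) - f (x + h *: u) - (f (x + h *: v) - f x) =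
    'D_v ('D_u f) (x + s *: u + t *: v) * (h * h)].
Proof.
move=> h0 df.
have h00 : 0 <= h <= h by rewrite lexx ltW.
have h01 : 0 <= (0 : R) <= h by rewrite lexx ltW.
have [s sh|s sh E0] := @MVT_from0 (fun s => f (x + s *: u + h *: v) - f (x + s *: u))
    (fun s => 'D_u f (x + s *: u + h *: v) - 'D_u f (x + s *: u)) h h0.
  have [df1 _] := df s h sh h00; have [df2 _] := df s 0 sh h01.
  rewrite scale0r addr0 in df2.
  apply: is_deriveB; last exact: is_derive_line.
  have E r : x + r *: u + h *: v = x + h *: v + r *: u by rewrite addrAC.
  have -> : (fun r => f (x + r *: u + h *: v)) = (fun r => f (x + h *: v + r *: u)).
    by apply/funext => r; rewrite E.
  rewrite E; rewrite E in df1.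
  exact: (@is_derive_line f (x + h *: v) u s df1).
rewrite !scale0r !addr0 in E0.
have [t th|t th] := @MVT_from0 (fun t => 'D_u f (x + s *: u + t *: v))
    (fun t => 'D_v ('D_u f) (x + s *: u + t *: v)) h h0.
  by apply: is_derive_line; have [] := df s t sh th.
rewrite scale0r addr0 => E; exists s, t; split=> //.
by rewrite E0 E mulrA.
Qed.

(** If two continuous functions share values at points of arbitrarily small parallelograms at [x],
    not necessarily at the same points, they agree at [x]. *)
Lemma eq_of_close_values (U : set V) (a b : V -> R^o) (x u v : V) : open U -> U x ->
  {for x, continuous a} -> {for x, continuous b} ->
  (forall h, 0 < h ->
    (forall s t, 0 <= s <= h -> 0 <= t <= h -> U (x + s *: u + t *: v)) ->
    exists s t s' t', [/\ 0 <= s <= h, 0 <= t <= h, 0 <= s' <= h, 0 <= t' <= h &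
      a (x + s *: u + t *: v) = b (x + s' *: u + t' *: v)]) ->
  a x = b x.
Proof.
move=> oU Ux aC bC ab.
have close (e A B P : R) : `|A - P| < e / 2%:R -> `|B - P| < e / 2%:R -> `|A - B| <= e.
  by move=> AP BP; rewrite ltW // [ltRHS]splitr (le_lt_trans (ler_distD P _ _)) //
    ltrD // distrC.
apply/eqP; rewrite -subr_eq0 -normr_le0; apply/ler_addgt0Pr => e e0; rewrite add0r.
have e2 : 0 < e / 2%:R by rewrite divr_gt0.
have near_a : \forall y \near x, `|a x - a y| < e / 2%:R.
  by move/cvgrPdist_lt : aC => /(_ _ e2).
have near_b : \forall y \near x, `|b x - b y| < e / 2%:R.
  by move/cvgrPdist_lt : bC => /(_ _ e2).
have : \forall y \near x, [/\ U y, `|a x - a y| < e / 2%:R & `|b x - b y| < e / 2%:R].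
  by apply: filterS3 (near_open oU Ux) near_a near_b.
move=> /nbhs_ballP[r /= r0 xr].
(* Every s u + t v with s, t in [0, h] then has norm below r; the + 1 keeps the denominator positive
   when u = v = 0. *)
pose h := r / (2%:R * (`|u| + `|v| + 1)).
have c0 : 0 < `|u| + `|v| + 1 by rewrite ltr_wpDl ?addr_ge0.
have h0 : 0 < h by rewrite divr_gt0 // mulr_gt0.
have inr s t : 0 <= s <= h -> 0 <= t <= h -> ball x r (x + s *: u + t *: v).
  move=> /andP[s0 sh] /andP[t0 th]; rewrite -ball_normE /ball_ /=.
  rewrite -addrA opprD addrA subrr add0r normrN.
  apply: (le_lt_trans (ler_normD _ _)); rewrite !normrZ !ger0_norm //.
  apply: (@le_lt_trans _ _ (h * (`|u| + `|v| + 1))).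
    have su := ler_wpM2r (normr_ge0 u) sh; have tv := ler_wpM2r (normr_ge0 v) th.
    by rewrite !mulrDr mulr1 -[leLHS]addr0 lerD ?lerD // ltW.
  rewrite /h invfM mulrA -!mulrA mulVf ?gt_eqF // mulr1.
  by rewrite ltr_pdivrMr // ltr_pMr // ltr1n.
have [|s [t [s' [t' [sh th sh' th' E]]]]] := ab h h0.
  by move=> s t sh th; have [] := xr _ (inr s t sh th).
have [_ a1 _] := xr _ (inr s t sh th).
have [_ _ b1] := xr _ (inr s' t' sh' th').
by rewrite E in a1; exact: close a1 b1.
Qed.

(** The second difference is symmetric in [u] and [v], so the two orders of the mean value theorem
    give equal values of the two mixed derivatives at nearby points. *)
Lemma Schwarz (U : set V) (f : V -> R^o) x u v : open U -> Ck_on 2 U f -> U x ->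
  'D_u ('D_v f) x = 'D_v ('D_u f) x.
Proof.
move=> oU [fd fC] Ux.
apply: (@eq_of_close_values U ('D_u ('D_v f)) ('D_v ('D_u f)) x u v oU Ux).
- by have [_ /(_ u)] := fC v; apply.
- by have [_ /(_ v)] := fC u; apply.
move=> h h0 inU.
have [|s [t [sh th E1]]] := @second_difference f x u v h h0.
  move=> s t sh th; have Uy := inU s t sh th.
  split; apply: diff_derivable; first exact: fd.
  by have [+ _] := fC u; apply.
have [|s' [t' [sh' th' E2]]] := @second_difference f x v u h h0.
  move=> s' t' sh' th'; have Uy : U (x + s' *: v + t' *: u) by rewrite addrAC; exact: inU.
  split; apply: diff_derivable; first exact: fd.
  by have [+ _] := fC v; apply.
rewrite [x + s' *: v + _]addrAC in E2.
exists t', s', s, t; split; [exact: th'|exact: sh'|exact: sh|exact: th|].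
apply: (@mulIf _ (h * h)); first by rewrite mulf_neq0 ?gt_eqF.
apply: etrans (esym E2) (etrans _ E1).
have -> : x + h *: v + h *: u = x + h *: u + h *: v by exact: addrAC.
move: (f (x + h *: u + h *: v)) (f (x + h *: u)) (f (x + h *: v)) (f x) => p q s0 t0.
by rewrite !opprB addrACA [RHS]addrACA [- q + _]addrC.
Qed.

End Schwarz.

(** * The Leibniz rule *)

Lemma is_derive_bigsum {R : realType} {V : normedModType R} (I : Type)
    (r : seq I) (f : I -> V -> R^o) (df : I -> R^o) x w :
  (forall i, is_derive x w (f i) (df i)) ->
  is_derive x w (fun y => \sum_(i <- r) f i y : R^o) (\sum_(i <- r) df i : R^o).
Proof.
move=> fdf; elim: r => [|i r IH].
  have -> : (fun y => \sum_(i <- [::]) f i y : R^o) = cst 0.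
    by apply/funext => y; rewrite big_nil.
  by rewrite big_nil; exact: is_derive_cst.
have -> : (fun y => \sum_(j <- i :: r) f j y : R^o) =
    f i + (fun y => \sum_(j <- r) f j y : R^o).
  by apply/funext => y; rewrite big_cons.
by rewrite big_cons; exact: is_deriveD.
Qed.

Lemma is_derive_mulr_cst {R : realType} {V : normedModType R} (f : V -> R^o) (df : R^o) x w (c : R) :
  is_derive x w f df -> is_derive x w (fun y => f y * c : R^o) (df * c : R^o).
Proof.
move=> fdf; have -> : (fun y => f y * c : R^o) = c *: f.
  by apply/funext => y; rewrite mulrC.
by rewrite mulrC; exact: is_deriveZ.
Qed.

Section ExteriorDerivative.
Context {R : realType}.
Local Notation V := (vec R).
Local Notation dx := (coframe (1%:M : 'M[R]_7)).

(** [ext_d] within one chart, [ext_d a c] being [chart_d (a c)]: the Leibniz rule becomes a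
    statement about maps on an open set of R^7. *)
Definition chart_d k (a : V -> covec R R k) (x : V) : covec R R k.+1 := fun v =>
  \sum_(i < k.+1) (-1) ^+ i * 'D_(v i) (fun y => a y (fun j => v (lift i j)) : R^o) x.

Lemma chart_d_near k (a b : V -> covec R R k) x v :
  (\forall y \near x, a y = b y) -> chart_d a x v = chart_d b x v.
Proof.
move=> ab; apply: eq_bigr => i _; congr (_ * _); apply: near_eq_derive.
by apply: filterS ab => y ->.
Qed.

Definition indices k (p : 'I_k -> 'I_7) : seq nat := [seq val (p i) | i <- enum 'I_k].

Lemma size_indices k (p : 'I_k -> 'I_7) : size (indices p) = k.
Proof. by rewrite size_map size_enum_ord. Qed.

Lemma eform_indices k (p : 'I_k -> 'I_7) v : eform ccoord p v = emon dx (indices p) v.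
Proof.
congr (\det _); apply/matrixP => i j; rewrite !mxE /indices.
rewrite (nth_map j) ?size_enum_ord // nth_ord_enum.
by rewrite coframe_ord mulmx1.
Qed.

Lemma emon_cons_expand (K : comNzRingType) (X : Type) (th : nat -> X -> K) k j s
    (v : 'I_k.+1 -> X) :
  emon th (j :: s) v =
  \sum_(i < k.+1) (-1) ^+ i * th j (v i) * emon th s (fun m => v (lift i m)).
Proof. by rewrite /emon eform_expand_first. Qed.

Lemma expand_indices k (f : covec R R k) v : multilinear f -> Defs.alternating f ->
  f v = \sum_(p : {ffun 'I_k -> 'I_7})
    ((k`!)%:R^-1 * f (fun i => basis_vec (p i))) * emon dx (indices p) v.
Proof.
move=> fM fA; rewrite {1}(alternating_expand fM fA coord_expand) mulr_sumr.
by apply: eq_bigr => p _; rewrite eform_indices mulrA.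
Qed.

Lemma derive_basis (f : V -> R^o) x v : differentiable f x ->
  'D_v f x = \sum_(j < 7) dx j v * 'D_(basis_vec j) f x.
Proof.
move=> df; rewrite deriveE // {1}(coord_expand v) linear_sum.
by apply: eq_bigr => j _; rewrite linearZ deriveE // coframe_ord mulmx1.
Qed.

(** The coordinate monomials are constant, so derivatives fall on the coefficients only; the
    alternating sum is then the column expansion of dx^j /\ dx^s. *)
Lemma chart_d_expand (I : finType) k (a : V -> covec R R k) (c : I -> V -> R^o)
    (s : I -> seq nat) x v :
  (\forall y \near x, forall w, a y w = \sum_q c q y * emon dx (s q) w) ->
  (forall q, differentiable (c q) x) ->
  chart_d a x v =
  \sum_q \sum_(j < 7) 'D_(basis_vec j) (c q) x * emon dx (nat_of_ord j :: s q) v.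
Proof.
move=> aE dc.
have D w u : 'D_w (fun y => a y u : R^o) x = \sum_q 'D_w (c q) x * emon dx (s q) u.
  apply: derive_val; apply: (@near_eq_is_derive _ _ _
    (fun y => \sum_q c q y * emon dx (s q) u : R^o)).
    by apply: filterS aE => y ->.
  apply: is_derive_bigsum => q; apply: is_derive_mulr_cst.
  by apply: derivableP; apply: diff_derivable.
rewrite /chart_d; under eq_bigr do rewrite D mulr_sumr.
rewrite exchange_big; apply: eq_bigr => q _ /=.
under [RHS]eq_bigr do rewrite emon_cons_expand mulr_sumr.
rewrite [RHS]exchange_big; apply: eq_bigr => i _ /=.
rewrite derive_basis // mulr_suml mulr_sumr; apply: eq_bigr => j _.
by rewrite !mulrA; congr (_ * _); rewrite mulrC mulrA.
Qed.

Lemma emon_move (K : comNzRingType) (X : Type) (th : nat -> X -> K) k j p s t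
    (v : 'I_k -> X) : size (s ++ j :: p ++ t) = k ->
  emon th (s ++ j :: p ++ t) v = (-1) ^+ size p * emon th (s ++ p ++ j :: t) v.
Proof.
elim: p s => [|i p IH] s /= sk; first by rewrite mul1r.
rewrite emon_swap // -cat_rcons IH; last by rewrite -sk cat_rcons !size_cat.
by rewrite cat_rcons exprS mulN1r mulNr.
Qed.

(* The hypothesis [d b = 0] avoids the term [a /\ d b], whose degree [k + l.+1] is
   not convertible to [(k + l).+1]. *)
Lemma chart_d_wedge (U : set V) k l (a : V -> covec R R k) (b : V -> covec R R l) x v :
  open U -> U x ->
  (forall y, U y -> multilinear (a y) /\ Defs.alternating (a y)) ->
  (forall y, U y -> multilinear (b y) /\ Defs.alternating (b y)) ->
  (forall w, differentiable (fun y => a y w : R^o) x) ->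
  (forall w, differentiable (fun y => b y w : R^o) x) ->
  (forall w, chart_d b x w = 0) ->
  chart_d (fun y => wedge_covec (a y) (b y)) x v =
  wedge_covec (chart_d a x) (b x) (v : 'I_(k.+1 + l) -> V).
Proof.
move=> oU Ux aM bM da db db0.
pose ca p y : R^o := (k`!)%:R^-1 * a y (fun i => basis_vec (p i)).
pose cb p y : R^o := (l`!)%:R^-1 * b y (fun i => basis_vec (p i)).
have near_U : \forall y \near x, U y by exact: near_open.
have dca (p : {ffun 'I_k -> 'I_7}) : differentiable (ca p) x.
  by apply: differentiableM => //; exact: differentiable_cst.
have dcb (p : {ffun 'I_l -> 'I_7}) : differentiable (cb p) x.
  by apply: differentiableM => //; exact: differentiable_cst.
have aE y w : U y -> a y w = \sum_(p : {ffun 'I_k -> 'I_7}) ca p y * emon dx (indices p) w.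
  by move=> /aM[? ?]; exact: expand_indices.
have bE y w : U y -> b y w = \sum_(p : {ffun 'I_l -> 'I_7}) cb p y * emon dx (indices p) w.
  by move=> /bM[? ?]; exact: expand_indices.
rewrite (@chart_d_expand _ _ _ (fun pq : {ffun 'I_k -> 'I_7} * {ffun 'I_l -> 'I_7} =>
    fun y => ca pq.1 y * cb pq.2 y : R^o)
  (fun pq => indices pq.1 ++ indices pq.2)); first last.
- by move=> pq; apply: differentiableM.
- apply: filterS near_U => y Uy w.
  have -> : a y = fun w => \sum_(p : {ffun 'I_k -> 'I_7}) ca p y * emon dx (indices p) w.
    by apply/funext => ?; exact: aE.
  have -> : b y = fun w => \sum_(p : {ffun 'I_l -> 'I_7}) cb p y * emon dx (indices p) w.
    by apply/funext => ?; exact: bE.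
  rewrite wedge_covec_suml -(pair_bigA _ (fun (p : {ffun 'I_k -> 'I_7})
    (q : {ffun 'I_l -> 'I_7}) => ca p y * cb q y * emon dx (indices p ++ indices q) w)) /=; apply: eq_bigr => p _.
  rewrite wedge_covec_sumr mulr_sumr; apply: eq_bigr => q _.
  by rewrite wedge_emon ?size_indices // mulrA.
have Da (w : 'I_k.+1 -> V) : chart_d a x w = \sum_(pj : {ffun 'I_k -> 'I_7} * 'I_7)
    'D_(basis_vec pj.2) (ca pj.1) x * emon dx (nat_of_ord pj.2 :: indices pj.1) w.
  rewrite (chart_d_expand (c := fun p : {ffun 'I_k -> 'I_7} => ca p)
    (s := fun p => indices p)) //; last first.
    by apply: filterS near_U => y Uy w'; exact: aE.
  by rewrite pair_bigA.
have Db (w : 'I_l.+1 -> V) : \sum_(pj : {ffun 'I_l -> 'I_7} * 'I_7)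
    'D_(basis_vec pj.2) (cb pj.1) x * emon dx (nat_of_ord pj.2 :: indices pj.1) w = 0.
  rewrite -[RHS](db0 w) (chart_d_expand (c := fun p : {ffun 'I_l -> 'I_7} => cb p)
    (s := fun p => indices p)) //; last first.
    by apply: filterS near_U => y Uy w'; exact: bE.
  by rewrite pair_bigA.
(* The product rule on coefficients splits the sum into the a /\ d b part, which vanishes, and the d
   a /\ b part. *)
transitivity (\sum_(p : {ffun 'I_k -> 'I_7}) \sum_(q : {ffun 'I_l -> 'I_7})
    \sum_(j < 7) ((ca p x * 'D_(basis_vec j) (cb q) x + cb q x * 'D_(basis_vec j) (ca p) x) *
    emon dx (nat_of_ord j :: indices p ++ indices q) v)).
  rewrite [RHS]pair_bigA; apply: eq_bigr => -[p q] _; apply: eq_bigr => j _ /=.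
  by congr (_ * _); rewrite deriveM //; apply: diff_derivable.
(* This sum is dx^p /\ d b. The degree [n] is left free because [k + l.+1] and the degree of [v] are
   equal but not convertible. *)
have vanish (p : 'I_k -> 'I_7) n (v' : 'I_n -> V) : (k + l.+1 = n)%N ->
    \sum_(qj : {ffun 'I_l -> 'I_7} * 'I_7) 'D_(basis_vec qj.2) (cb qj.1) x *
      emon dx (indices p ++ nat_of_ord qj.2 :: indices qj.1) v' = 0.
  move=> e; subst n.
  transitivity (wedge_covec (emon dx (indices p) : covec R R k)
      ((fun=> 0) : covec R R l.+1) v').
    rewrite -[in RHS](funext Db) wedge_covec_sumr; apply: eq_bigr => qj _.
    by rewrite wedge_emon ?size_indices.
  by rewrite /wedge_covec big1 ?mulr0 // => s _; rewrite mulr0.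
transitivity (\sum_(p : {ffun 'I_k -> 'I_7}) \sum_(q : {ffun 'I_l -> 'I_7})
    \sum_(j < 7) (cb q x * 'D_(basis_vec j) (ca p) x *
    emon dx (nat_of_ord j :: indices p ++ indices q) v)).
  apply: eq_bigr => p _; under eq_bigr do under eq_bigr do rewrite mulrDl.
  under eq_bigr do rewrite big_split /=.
  rewrite big_split /= -[RHS]add0r; congr (_ + _).
  (* Moving dx^j past the k covectors of dx^p costs (-1)^k and exposes dx^p /\ d b. *)
  transitivity (ca p x * (-1) ^+ k * \sum_(qj : {ffun 'I_l -> 'I_7} * 'I_7)
     'D_(basis_vec qj.2) (cb qj.1) x *
      emon dx (indices p ++ nat_of_ord qj.2 :: indices qj.1) v); last first.
    by rewrite vanish ?mulr0 // addnS.
  rewrite pair_bigA mulr_sumr; apply: eq_bigr => -[q j] _ /=.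
  rewrite (@emon_move _ _ dx _ j (indices p) [::]) /= ?size_cat ?size_indices //.
  exact: mulrACA.
transitivity (wedge_covec (fun w => \sum_(pj : {ffun 'I_k -> 'I_7} * 'I_7)
    'D_(basis_vec pj.2) (ca pj.1) x * emon dx (nat_of_ord pj.2 :: indices pj.1) w :
    R) (b x : covec R R l) (v : 'I_(k.+1 + l) -> V)); last first.
  by congr wedge_covec; apply/funext => w; rewrite Da.
rewrite wedge_covec_suml -(pair_bigA _ (fun (p : {ffun 'I_k -> 'I_7}) (j : 'I_7) =>
  'D_(basis_vec j) (ca p) x *
     wedge_covec (emon dx (nat_of_ord j :: indices p) : covec R R k.+1) (b x) v)).
apply: eq_bigr => p _; rewrite exchange_big; apply: eq_bigr => j _ /=.
have -> : b x = fun w => \sum_(p : {ffun 'I_l -> 'I_7}) cb p x * emon dx (indices p) w.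
  by apply/funext => ?; exact: bE.
rewrite wedge_covec_sumr mulr_sumr; apply: eq_bigr => q _.
by rewrite wedge_emon /= ?size_indices // mulrA; congr (_ * _); rewrite mulrC.
Qed.

End ExteriorDerivative.

(** * Fields of forms *)

Section Forms.
Context {R : realType} {M : smooth_manifold7 R}.
Local Notation V := (vec R).

Lemma is_form_wedge k l (a : dform M k) (b : dform M l) :
  is_form a -> is_form b -> is_form (wedge_form a b : dform M (k + l)).
Proof.
move=> [[aM aS aT] aA] [[bM bS bT] bA]; split; last first.
  by move=> c x cx; apply: wedge_alternating; [exact: aM|exact: aA|exact: bM|exact: bA].
split=> [c x cx|c v|c c' x cx v].
- by apply: wedge_multilinear; [exact: aM|exact: aA|exact: bM|exact: bA].
- have oc := @codom_open R M c.
  apply: smooth_onZ => //; apply: smooth_on_sum => // s.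
  apply: (@smooth_onM _ _ _ oc
    (fun x => (-1) ^+ s * a c x (fun i => v (s (lshift l i))))
    (fun x => b c x (fun j => v (s (rshift k j))))); last exact: bS.
  by apply: smooth_onZ => //; exact: aS.
- rewrite /wedge_form /wedge_covec; congr (_ * _); apply: eq_bigr => s _.
  by rewrite (aT _ _ _ cx) (bT _ _ _ cx).
Qed.

Lemma is_formZ k (r : R) (a : dform M k) : is_form a -> is_form (r *: a).
Proof.
move=> [[aM aS aT] aA]; split; last by move=> c x cx; apply: alternatingZ; exact: aA.
split=> [c x cx|c v|c c' x cx v].
- by apply: multilinearZ; exact: aM.
- by apply: smooth_onZ; [exact: codom_open|exact: aS].
- by congr (_ * _); exact: aT.
Qed.

Lemma is_formD k (a b : dform M k) : is_form a -> is_form b -> is_form (a + b).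
Proof.
move=> [[aM aS aT] aA] [[bM bS bT] bA]; split; last first.
  by move=> c x cx; apply: alternatingD; [exact: aA|exact: bA].
split=> [c x cx|c v|c c' x cx v].
- by apply: multilinearD; [exact: aM|exact: bM].
- by apply: smooth_onD; [exact: codom_open|exact: aS|exact: bS].
- by congr (_ + _); [exact: aT|exact: bT].
Qed.

Lemma ext_d_eq k (a b : dform M k) c x v :
  (forall y, chart_codom c y -> forall w, a c y w = b c y w) -> chart_codom c x ->
  ext_d a c x v = ext_d b c x v.
Proof.
move=> ab cx; apply: (@chart_d_near R k (a c) (b c)).
apply: filterS (near_open (@codom_open R M c) cx) => y cy; apply/funext => w.
exact: ab.
Qed.

Lemma is_form_differentiable k (a : dform M k) c x w :
  is_form a -> chart_codom c x -> differentiable (fun y => a c y w : R^o) x.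
Proof.
by move=> [[_ aS _] _] cx; apply: smooth_on_differentiable (aS c w) cx.
Qed.

Lemma ext_dZ k (r : R) (a : dform M k) c x v : is_form a -> chart_codom c x ->
  ext_d (r *: a) c x v = r * ext_d a c x v.
Proof.
move=> aF cx; rewrite /ext_d mulr_sumr; apply: eq_bigr => i _.
rewrite mulrCA; congr (_ * _).
apply: (@deriveZ _ _ _ (fun y => a c y (fun j => v (lift i j)) : R^o)).
by apply: diff_derivable; exact: is_form_differentiable.
Qed.

Lemma ext_dD k (a b : dform M k) c x v : is_form a -> is_form b -> chart_codom c x ->
  ext_d (a + b) c x v = ext_d a c x v + ext_d b c x v.
Proof.
move=> aF bF cx; rewrite /ext_d -big_split; apply: eq_bigr => i _ /=.
rewrite -mulrDr; congr (_ * _).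
apply: (@deriveD _ _ _ (fun y => a c y (fun j => v (lift i j)) : R^o)
  (fun y => b c y (fun j => v (lift i j)) : R^o)).
  by apply: diff_derivable; exact: is_form_differentiable.
by apply: diff_derivable; exact: is_form_differentiable.
Qed.

Lemma ext_d_wedge k l (a : dform M k) (b : dform M l) c x v :
  is_form a -> is_form b -> chart_codom c x -> closed_form b ->
  ext_d (wedge_form a b : dform M (k + l)) c x v =
  (wedge_form (ext_d a) b : dform M (k.+1 + l)) c x v.
Proof.
move=> aF bF cx bd; apply: (@chart_d_wedge _ (chart_codom c) k l (a c) (b c) x v) => //.
- exact: codom_open.
- by move=> y cy; have [[+ _ _] aA] := aF; move=> /(_ c y cy); split=> //; exact: aA.
- by move=> y cy; have [[+ _ _] bA] := bF; move=> /(_ c y cy); split=> //; exact: bA.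
- by move=> w; exact: is_form_differentiable.
- by move=> w; exact: is_form_differentiable.
- by move=> w; exact: bd.
Qed.

End Forms.

(** * Contact Calabi-Yau manifolds *)

Section ContactCalabiYau.
Context {R : realType} {M : smooth_manifold7 R}.
Local Notation V := (vec R).
Variables (g : bilinear_field M) (eta : dform M 1) (Ups : cform M 3).
Variables (xi : vector_field (M := M)) (Phi : endo_field (M := M)).
Hypothesis S : sasakian g eta xi Phi.
Hypothesis UpsF : is_cform Ups.
Hypothesis Ups30 : transverse_30 eta xi Phi Ups.
Hypothesis Ups_closed : closed_cform Ups.
Hypothesis Ups_vol : eq_on_M
  (fun c x v => (3`!)%:R^-1 * form_cube (cform_of (ext_d eta)) c x v)
  (fun c x v => Complex 0 1 / 8%:R * wedge_form Ups (conj_form Ups) c x v).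

Local Notation omega := (ext_d eta).

Let etaF : is_form eta := sas_eta S.

Lemma ord1_const (T : Type) (v : 'I_1 -> T) : v = fun=> v ord0.
Proof. by apply/funext => i; rewrite ord1. Qed.

Lemma ord2_cons (v : 'I_2 -> V) : v = cons_vec (v ord0) (fun=> v ord_max).
Proof.
rewrite -{1}[v]cons_vec_eta; congr cons_vec; apply/funext => i /=.
by congr v; apply: val_inj; rewrite /= ord1.
Qed.

Lemma omega_metric c x (v : 'I_2 -> V) : chart_codom c x ->
  omega c x v = g c x (Phi c x (v ord0)) (v ord_max).
Proof. by move=> cx; rewrite -(sas_kahler S) // /eval2 -ord2_cons. Qed.

Lemma metricL c x : chart_codom c x ->
  forall w a u v, g c x (a *: u + v) w = a * g c x u w + g c x v w.
Proof.
move=> cx w a u v; have [[gM _ _] _ _] := sas_metric S.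
exact: (gM c x cx (fun=> w) ord0 a u v).
Qed.

Lemma metricC c x : chart_codom c x -> forall u v, g c x u v = g c x v u.
Proof. by move=> cx; have [_ gC _] := sas_metric S; exact: gC. Qed.

Lemma etaE c x (v : 'I_1 -> V) : eta c x v = eval1 eta c x (v ord0).
Proof. by rewrite [in LHS](ord1_const v). Qed.

Lemma etaL c x : chart_codom c x -> forall a u v,
  eval1 eta c x (a *: u + v) = a * eval1 eta c x u + eval1 eta c x v.
Proof.
move=> cx a u v; have [[etaM _ _] _] := etaF.
have := etaM c x cx (fun=> 0) ord0 a u v.
by rewrite !etaE /=.
Qed.

Lemma PhiL c x : chart_codom c x -> forall a u v,
  Phi c x (a *: u + v) = a *: Phi c x u + Phi c x v.
Proof. by move=> cx; have [PhiL _ _] := sas_Phi S; exact: PhiL. Qed.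

(** Compatibility under chart changes and multilinearity come from d eta = g(Phi ., .), without
    naturality of [ext_d]; alternation and smoothness are read off its defining formula. *)
Lemma omega_form : is_form omega.
Proof.
have gF := sas_metric S; have [[gM _ gT] gC _] := gF.
have [_ _ PhiT] := sas_Phi S; have [[_ etaS _] _] := etaF.
split; last first.
  move=> c x cx v i j ij vij.
  have -> : v = fun=> v i.
    apply/funext => m; case: (eqVneq m i) => [->//|mi]; rewrite vij; congr v.
    apply: val_inj; move: ij mi; rewrite -!val_eqE.
    by case: i j m {vij} => [[|[|//]] ?] [[|[|//]] ?] [[|[|//]] ?].
  rewrite /ext_d !big_ord_recl big_ord0 /= addr0 expr0 mul1r.
  by rewrite /bump /= expr1 mulN1r subrr.
split=> [c x cx|c v|c c' x cx v].
- move=> v i a u w; rewrite !omega_metric //.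
  case: i => [[|[|//]] ?] /=.
    by rewrite PhiL // metricL.
  by rewrite metricC // metricL // !(metricC _ (Phi _ _ _)).
- have oc := @codom_open R M c.
  apply: smooth_on_sum => // i; apply: smooth_onZ => //.
  by apply: smooth_on_derive; exact: etaS.
- have cx' : chart_codom c x by case: cx.
  have cx'' : chart_codom c' (transition c c' x).
    by case: cx => _ /= ?; exact: coord_codom.
  rewrite !omega_metric // PhiT //.
  exact: (gT c c' x cx (fun i : 'I_2 => if i == ord0 then Phi c x (v ord0) else v ord_max)).
Qed.

(** This is d d eta = 0: the six second derivatives cancel in pairs by [Schwarz]. *)
Lemma omega_closed : closed_form omega.
Proof.
move=> c x cx v; have [[_ etaS _] _] := etaF; have oc := @codom_open R M c.
pose h u : V -> R^o := fun y => eta c y (fun=> u).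
have omegaE (w : 'I_2 -> V) : (fun y => omega c y w : R^o) =
    ('D_(w ord0) (h (w ord_max)) : V -> R^o) - 'D_(w ord_max) (h (w ord0)).
  apply/funext => y; rewrite /ext_d !big_ord_recl big_ord0 /= addr0 expr0 mul1r.
  rewrite /bump /= expr1 mulN1r.
  have l0 : (fun j : 'I_1 => w (lift ord0 j)) = fun=> w ord_max.
    by apply/funext => j; congr w; apply: val_inj; rewrite /= ord1.
  have l1 : (fun j : 'I_1 => w (lift (lift ord0 ord0) j)) = fun=> w ord0.
    by apply/funext => j; congr w; apply: val_inj; rewrite /= ord1.
  by rewrite l0 l1 (_ : lift ord0 ord0 = ord_max) //; apply: val_inj.
(* An opaque [T] hides the derivatives, so that the cancellation is a polynomial identity in
   atoms. *)
have [T TE] : exists T : V -> V -> V -> R,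
    forall a b u, T a b u = 'D_a ('D_b (h u)) x.
  by exists (fun a b u => 'D_a ('D_b (h u)) x).
have D a (w : 'I_2 -> V) : 'D_a (fun y => omega c y w : R^o) x =
    T a (w ord0) (w ord_max) - T a (w ord_max) (w ord0).
  rewrite !TE omegaE deriveB //; apply: diff_derivable;
    by apply: smooth_on_differentiable cx; apply: smooth_on_derive; exact: etaS.
have Sw a b u : T a b u = T b a u.
  by rewrite !TE; apply: Schwarz oc _ cx; exact: etaS.
clear TE; transitivity (\sum_(i < 3) (-1) ^+ i *
    (T (v i) (v (lift i ord0)) (v (lift i ord_max)) -
     T (v i) (v (lift i ord_max)) (v (lift i ord0)))).
  by apply: eq_bigr => i _; congr (_ * _); exact: D.
rewrite !big_ord_recl big_ord0 /= /bump /= addr0 expr0 mul1r.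
rewrite (_ : (-1) ^+ (1 + 0) = -1 :> R) // (_ : (-1) ^+ (1 + (1 + 0)) = 1 :> R) //; last first.
  by rewrite -signr_odd.
pose v0 := v ord0; pose v1 := v (lift ord0 ord0); pose v2 := v (lift ord0 (lift ord0 ord0)).
have e1 : v (lift ord0 ord_max) = v2 by congr v; apply: val_inj.
have e2 : v (lift (lift ord0 ord0) ord0) = v0 by congr v; apply: val_inj.
have e3 : v (lift (lift ord0 ord0) ord_max) = v2 by congr v; apply: val_inj.
have e4 : v (lift (lift ord0 (lift ord0 ord0)) ord0) = v0 by congr v; apply: val_inj.
have e5 : v (lift (lift ord0 (lift ord0 ord0)) ord_max) = v1 by congr v; apply: val_inj.
rewrite e1 e2 e3 e4 e5 -/v0 -/v1 -/v2 (Sw v1 v0) (Sw v2 v0) (Sw v2 v1).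
rewrite mulN1r mul1r; ring.
Qed.

Lemma point_coframe c x lam : chart_codom c x -> 0 < lam ->
  exists2 A : 'M[R]_7, A \in unitmx &
  [/\ forall v, coframe A 0%N v = lam * eval1 eta c x v,
      forall u w, \sum_(m < 7) coframe A m u * coframe A m w =
        lam ^+ 2 * (eval1 eta c x u * eval1 eta c x w) + transverse_metric g eta c x u w,
      forall v, omega c x v = ieval (coframe A) iomega v,
      forall v, re_form Ups c x v = ieval (coframe A) ire v &
      forall v, im_form Ups c x v = ieval (coframe A) iim v].
Proof.
move=> cx lam0.
have [[reM _ _] reA] := UpsF.1; have [[imM _ _] imA] := UpsF.2.
have [Uxi UPhi] := Ups30 cx.
have [_ _ gP] := sas_metric S.
have [ | |A uA [h0 h1 h2 h3 h4]] := @adapted_coframe R (g c x) (xi c x) (Phi c x)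
  (eval1 eta c x) (metricL cx) (metricC cx) (gP c x cx) (PhiL cx) (etaL cx)
  (sas_eta_xi S cx) _ (sas_Phi2 S cx) (sas_compatible S cx) (Ups c x)
  (reM c x cx) (reA c x cx) (imM c x cx) (imA c x cx) Uxi UPhi _ lam lam0.
(* g(Phi xi, u) = d eta(xi, u) = 0 is the Reeb condition. *)
- by move=> u; rewrite -(sas_kahler S cx) (sas_reeb S cx).
- move=> v w; rewrite -[RHS](Ups_vol cx); congr (_ * _).
  rewrite /form_cube /wedge_form /cform_of.
  suff -> : (fun v0 : 'I_2 -> V => real_complex R (omega c x v0)) = w by [].
  by apply/funext => u; rewrite omega_metric.
exists A => //; split=> // v; by rewrite omega_metric.
Qed.

(* [lam] is the value [eps * q(t)]. *)
Variable lam : R.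
Hypothesis lam_gt0 : 0 < lam.

(** One time slice: time enters the geometry only through [lam], so the flow reduces to an ordinary
    differential equation for [lam]. *)
Definition cphi : dform M 3 := lam *: (wedge_form eta omega : dform M 3) + re_form Ups.
Definition cpsi : dform M 4 := (1 / 2%:R) *: (wedge_form omega omega : dform M 4)
  - lam *: (wedge_form eta (im_form Ups) : dform M 4).
Definition cmet : bilinear_field M := fun c x u v =>
  lam ^+ 2 * (eval1 eta c x u * eval1 eta c x v) + transverse_metric g eta c x u v.
Definition cvol : dform M 7 := lam *: (wedge_form eta (volD eta) : dform M 7).

Let imF : is_form (im_form Ups) := UpsF.2.

Lemma eta_omega_form : is_form (wedge_form eta omega : dform M 3).
Proof. exact: (is_form_wedge etaF omega_form). Qed.

Lemma omega2_form : is_form (wedge_form omega omega : dform M 4).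
Proof. exact: (is_form_wedge omega_form omega_form). Qed.

Lemma eta_im_form : is_form (wedge_form eta (im_form Ups) : dform M 4).
Proof. exact: (is_form_wedge etaF imF). Qed.

Lemma cphi_form : is_form cphi.
Proof. exact: is_formD (is_formZ lam eta_omega_form) UpsF.1. Qed.

Lemma cvol_form : is_form cvol.
Proof.
apply: is_formZ; apply: (is_form_wedge etaF); apply: is_formZ.
exact: (is_form_wedge omega2_form omega_form).
Qed.

(** * Pointwise identities in an adapted coframe *)

Section AtPoint.
Variables (c : chart M) (x : V) (A : 'M[R]_7).
Hypothesis cx : chart_codom c x.
Hypothesis unitA : A \in unitmx.
Hypothesis hA : [/\ forall v, coframe A 0%N v = lam * eval1 eta c x v,
      forall u w, \sum_(m < 7) coframe A m u * coframe A m w =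
        lam ^+ 2 * (eval1 eta c x u * eval1 eta c x w) + transverse_metric g eta c x u w,
      forall v, omega c x v = ieval (coframe A) iomega v,
      forall v, re_form Ups c x v = ieval (coframe A) ire v &
      forall v, im_form Ups c x v = ieval (coframe A) iim v].

Lemma eta_ieval : eta c x = fun v => lam^-1 * ieval (coframe A) ieta v.
Proof.
have [h0 _ _ _ _] := hA; apply/funext => v.
rewrite etaE /ieval big_seq1 mul1r /emon /eform det_mx11 mxE h0.
by rewrite mulKf // gt_eqF.
Qed.

Lemma omega_ieval : omega c x = ieval (coframe A) iomega.
Proof. by have [_ _ h _ _] := hA; apply/funext. Qed.

Lemma re_ieval : re_form Ups c x = ieval (coframe A) ire.
Proof. by have [_ _ _ h _] := hA; apply/funext. Qed.

Lemma im_ieval : im_form Ups c x = ieval (coframe A) iim.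
Proof. by have [_ _ _ _ h] := hA; apply/funext. Qed.

Lemma eta_omega_ieval : (wedge_form eta omega : dform M 3) c x =
  fun v => lam^-1 * ieval (coframe A) (iwedge ieta iomega) v.
Proof.
apply/funext => v; rewrite /wedge_form eta_ieval omega_ieval.
by rewrite (@wedge_covecZl R R 1 2) (@ieval_wedge R R _ 1 2).
Qed.

Lemma omega2_ieval : (wedge_form omega omega : dform M 4) c x =
  ieval (coframe A) (iwedge iomega iomega).
Proof.
by apply/funext => v; rewrite /wedge_form omega_ieval (@ieval_wedge R R _ 2 2).
Qed.

Lemma eta_im_ieval : (wedge_form eta (im_form Ups) : dform M 4) c x =
  fun v => lam^-1 * ieval (coframe A) (iwedge ieta iim) v.
Proof.
apply/funext => v; rewrite /wedge_form eta_ieval im_ieval.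
by rewrite (@wedge_covecZl R R 1 3) (@ieval_wedge R R _ 1 3).
Qed.

Lemma cphi_ieval : cphi c x = ieval (coframe A) iphi.
Proof.
apply/funext => v; rewrite /iphi ieval_cat -re_ieval.
congr (_ + _); rewrite -[LHS]/(lam * (wedge_form eta omega : dform M 3) c x v).
by rewrite eta_omega_ieval mulVKf // gt_eqF.
Qed.

Lemma cvol_ieval : cvol c x = ieval (coframe A) ivol.
Proof.
apply/funext => v.
rewrite -[LHS]/(lam * wedge_covec (eta c x : covec R R 1)
  (fun w => (3`!)%:R^-1 * wedge_covec (wedge_covec (omega c x) (omega c x))
     (omega c x) w : R) v).
rewrite eta_ieval omega_ieval (@wedge_covecZl R R 1 6) (@wedge_covecZr R R 1 6).
have w2 : wedge_covec (ieval (coframe A) iomega : covec R R 2)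
    (ieval (coframe A) iomega : covec R R 2) = ieval (coframe A) (iwedge iomega iomega).
  by apply/funext => w; rewrite (@ieval_wedge R R _ 2 2).
have w3 : wedge_covec (ieval (coframe A) (iwedge iomega iomega) : covec R R 4)
    (ieval (coframe A) iomega : covec R R 2) =
    ieval (coframe A) (iwedge (iwedge iomega iomega) iomega).
  by apply/funext => w; rewrite (@ieval_wedge R R _ 4 2).
rewrite mulVKf ?gt_eqF // w2 w3.
by rewrite (@ieval_wedge R R _ 1 6) // eta_omega3 mulKf // pnatr_eq0.
Qed.

Lemma cmet_coframe u w : cmet c x u w = \sum_(m < 7) coframe A m u * coframe A m w.
Proof. by have [_ -> _ _ _] := hA. Qed.

Lemma hodge_cphi v : @hodge R M cmet cvol 3 4 cphi c x v = cpsi c x v.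
Proof.
rewrite /hodge cphi_ieval cvol_ieval (star_phi unitA _ cmet_coframe).
rewrite -[RHS]/(1 / 2%:R * (wedge_form omega omega : dform M 4) c x v
  - lam * (wedge_form eta (im_form Ups) : dform M 4) c x v).
by rewrite omega2_ieval eta_im_ieval mulVKf // gt_eqF.
Qed.

(** The star of omega^2 is 2 e^0 /\ omega, and e^0 = lam eta: each star contributes one factor
    [lam]. *)
Lemma hodge_omega2 (s : R) v :
  @star_covec R 4 3 (cmet c x) (cvol c x)
    (fun w => s * (wedge_form omega omega : dform M 4) c x w) v =
  s * (2%:R * lam) * (wedge_form eta omega : dform M 3) c x v.
Proof.
rewrite cvol_ieval omega2_ieval eta_omega_ieval.
have := @star_covec_sum R _ [:: tt] (fun=> s) 4 3 (cmet c x) (ieval (coframe A) ivol)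
  (fun=> ieval (coframe A) (iwedge iomega iomega)) v.
rewrite big_seq1 => E; rewrite -[RHS]mulrA -[_ * _ * (_ * _)]mulrA mulVKf ?gt_eqF //.
rewrite -(star_omega2 unitA _ cmet_coframe) -E; congr star_covec.
by apply/funext => w; rewrite big_seq1.
Qed.

Lemma omega_im_0 v : (wedge_form omega (im_form Ups) : dform M 5) c x v = 0.
Proof.
rewrite /wedge_form omega_ieval im_ieval (@ieval_wedge R R _ 2 3) //.
exact: omega_wedge_im.
Qed.

Lemma cphi_g2_covec : g2_covec (cphi c x).
Proof. by exists A => // v; rewrite g2_model_coframe cphi_ieval. Qed.

Lemma cphi_identity u w (v : 'I_7 -> V) : 6%:R * cmet c x u w * cvol c x v =
  wedge_covec (wedge_covec (Defs.contraction u (cphi c x))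
                           (Defs.contraction w (cphi c x))) (cphi c x) v.
Proof.
rewrite cphi_ieval cvol_ieval; exact: (g2_identity unitA _ _ _ cmet_coframe).
Qed.

Lemma cmet_gt0 u : u != 0 -> 0 < cmet c x u u.
Proof.
move=> u0; rewrite cmet_coframe lt0r; apply/andP; split; last first.
  by apply: sumr_ge0 => m _; rewrite -expr2 sqr_ge0.
apply: contra u0; rewrite psumr_eq0 => [/allP h0|m _]; last first.
  by rewrite -expr2 sqr_ge0.
rewrite -[u](mulmxK unitA); apply/eqP; rewrite (_ : u *m A = 0) ?mul0mx //.
apply/rowP => m; rewrite [RHS]mxE -coframe_ord.
by have := h0 m (mem_index_enum _); rewrite mulf_eq0 orbb => /eqP.
Qed.

(** The value is the determinant of the component matrix of [f], which is orthogonal. *)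
Lemma cvol_orthonormal f : Defs.orthonormal (cmet c x) f -> `|cvol c x f| = 1.
Proof.
move=> fO; rewrite cvol_ieval /ieval big_seq1 mul1r.
pose P := \matrix_(i < 7, j < 7) coframe A j (f i).
have -> : emon (coframe A) (iota 0 7) f = \det P.
  by congr (\det _); apply/matrixP => i j; rewrite !mxE nth_iota.
have PP : P *m P^T = 1%:M.
  apply/matrixP => i j; rewrite !mxE -fO cmet_coframe.
  by apply: eq_bigr => m _; rewrite !mxE.
apply/eqP; rewrite -(@eqrXn2 _ 2) // real_normK ?num_real // expr1n.
by rewrite expr2 -{2}det_tr -det_mulmx PP det1.
Qed.

End AtPoint.

Lemma cmet_metric : is_metric cmet.
Proof.
have [[_ gS gT] _ _] := sas_metric S; have [[_ etaS etaT] _] := etaF.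
have cmetL c x : chart_codom c x -> forall w a u v,
    cmet c x (a *: u + v) w = a * cmet c x u w + cmet c x v w.
  move=> cx w a u v.
  by rewrite /cmet /transverse_metric metricL // etaL //; ring.
have cmetC c x : chart_codom c x -> forall u v, cmet c x u v = cmet c x v u.
  by move=> cx u v; rewrite /cmet /transverse_metric metricC // (mulrC (eval1 _ _ _ u)).
split; last 2 first.
- exact: cmetC.
- move=> c x cx u u0; have [A uA hA] := point_coframe cx lam_gt0.
  exact: cmet_gt0 uA hA u u0.
split=> [c x cx v i a u w|c v|c c' x cx v].
- case: i => [[|[|//]] ?] /=; first by rewrite cmetL.
  by rewrite cmetC // cmetL // !(cmetC _ _ cx (v ord0)).
- have oc := @codom_open R M c.
  have eS u : smooth_on (chart_codom c) (fun x => eval1 eta c x u : R^o) by exact: etaS.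
  have eeS := smooth_onM oc (eS (v ord0)) (eS (v ord_max)).
  apply: smooth_onD => //; first exact: smooth_onZ.
  apply: (@smooth_onD _ _ _ oc _ (fun x => g c x (v ord0) (v ord_max) : R^o)
    (fun x => - (eval1 eta c x (v ord0) * eval1 eta c x (v ord_max)) : R^o)).
    exact: gS.
  move: (smooth_onZ oc (-1) eeS).
  by congr smooth_on; apply/funext => x; rewrite mulN1r.
- have eT u : eval1 eta c x u = eval1 eta c' (transition c c' x) ('d (transition c c') x u).
    exact: (etaT c c' x cx (fun=> u)).
  rewrite /cmet /transverse_metric (eT (v ord0)) (eT (v ord_max)).
  by congr (_ + (_ - _)); exact: gT.
Qed.

(** d(omega^2) vanishes because omega is closed, whereas d(eta /\ Im Ups) = omega /\ Im Ups vanishes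
    for algebraic reasons, by type. *)
Lemma cpsi_closed : closed_form cpsi.
Proof.
move=> c x cx v.
rewrite /cpsi -scaleNr ext_dD //; last 2 first.
- exact: is_formZ omega2_form.
- exact: is_formZ eta_im_form.
rewrite (ext_dZ _ _ omega2_form cx) (ext_dZ _ _ eta_im_form cx).
rewrite (@ext_d_wedge R M 2 2 _ _ c x v omega_form omega_form cx omega_closed).
rewrite (@ext_d_wedge R M 1 3 _ _ c x v etaF imF cx Ups_closed.2).
have [A uA hA] := point_coframe cx lam_gt0.
rewrite (omega_im_0 hA) mulr0 addr0.
rewrite /wedge_form (_ : ext_d omega c x = fun=> 0) ?wedge0l ?mulr0 //.
by apply/funext => w; exact: omega_closed.
Qed.

Lemma cphi_coclosed : coclosed_g2_structure cphi cmet cvol cpsi.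
Proof.
split.
- split; first exact: cphi_form.
  move=> c x cx; have [A uA hA] := point_coframe cx lam_gt0.
  exact: cphi_g2_covec uA hA.
- split; first exact: cmet_metric.
    split; first exact: cvol_form.
    move=> c x cx f; have [A uA hA] := point_coframe cx lam_gt0.
    exact: (cvol_orthonormal hA).
  move=> c x cx u w v; have [A uA hA] := point_coframe cx lam_gt0.
  exact: (cphi_identity uA hA).
- move=> c x cx v; have [A uA hA] := point_coframe cx lam_gt0.
  by rewrite (hodge_cphi uA hA).
- exact: cpsi_closed.
Qed.

Lemma star_covec0 k l (h : V -> V -> R) (vol : covec R R 7) (v : 'I_l -> V) :
  @star_covec R k l h vol (fun=> 0) v = 0.
Proof.
rewrite /star_covec big1 ?mulr0 // => p _; rewrite big1 // => q _.
by rewrite mulr0 mul0r.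
Qed.

Lemma ext_d_cphi c x v : chart_codom c x ->
  ext_d cphi c x v = lam * (wedge_form omega omega : dform M 4) c x v.
Proof.
move=> cx; rewrite /cphi (ext_dD v (is_formZ lam eta_omega_form) UpsF.1 cx).
rewrite (ext_dZ _ _ eta_omega_form cx).
by rewrite (@ext_d_wedge R M 1 2 _ _ c x v etaF omega_form cx omega_closed) Ups_closed.1 // addr0.
Qed.

Lemma laplacian_cphi c x v : chart_codom c x ->
  hodge_laplacian cmet cvol cphi c x v =
  4%:R * lam ^+ 3 * (wedge_form eta omega : dform M 3) c x v.
Proof.
move=> cx; rewrite -[LHS]/(ext_d (codifferential cmet cvol cphi) c x v +
  codifferential cmet cvol (ext_d cphi) c x v).
(* Up to sign d^* phi is the star of d psi, as psi is the star of phi; the equality is needed on the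
   whole chart image because [ext_d] is applied to it. *)
have dphi0 y : chart_codom c y -> forall w,
    codifferential cmet cvol cphi c y w = (0 : dform M 2) c y w.
  move=> cy w; rewrite -[LHS]/((-1) ^+ 3 * star_covec (cmet c y) (cvol c y)
    (fun u : 'I_5 -> V => ext_d (@hodge R M cmet cvol 3 4 cphi) c y u) w).
  rewrite (_ : (fun u : 'I_5 -> V => _) = fun=> 0) ?star_covec0 ?mulr0 //.
  apply/funext => u; rewrite -[RHS](cpsi_closed cy u); apply: ext_d_eq cy => z cz w'.
  have [A uA hA] := point_coframe cz lam_gt0.
  exact: (hodge_cphi uA hA).
rewrite (ext_d_eq v dphi0 cx) (_ : ext_d (0 : dform M 2) c x v = 0) ?add0r; last first.
  rewrite /ext_d big1 // => i _.
  rewrite (_ : (fun y => _) = cst 0) ?derive_cst ?mulr0 //.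
(* The star of d phi is 2 lam^2 eta /\ omega, a constant multiple of a global form, and can
   therefore be differentiated. *)
have hodge_dphi y : chart_codom c y -> forall w,
    @hodge R M cmet cvol 4 3 (ext_d cphi) c y w =
    ((2%:R * lam ^+ 2) *: (wedge_form eta omega : dform M 3)) c y w.
  move=> cy w; have [A uA hA] := point_coframe cy lam_gt0.
  rewrite /hodge (_ : ext_d cphi c y = fun u =>
    lam * (wedge_form omega omega : dform M 4) c y u); last first.
    by apply/funext => u; rewrite ext_d_cphi.
  rewrite (hodge_omega2 uA hA) -[RHS]/(_ * _); congr (_ * _); ring.
(* On 4-forms d^* is star d star with sign +1; the second star gives 2 lam times 2 lam^2. *)
rewrite -[LHS]/((-1) ^+ 4 * @star_covec R 4 3 (cmet c x) (cvol c x)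
   (ext_d (@hodge R M cmet cvol 4 3 (ext_d cphi)) c x) v).
rewrite (_ : ext_d (@hodge R M cmet cvol 4 3 (ext_d cphi)) c x = fun u =>
  (2%:R * lam ^+ 2) * (wedge_form omega omega : dform M 4) c x u); last first.
  apply/funext => u; rewrite (ext_d_eq u hodge_dphi cx) (ext_dZ _ _ eta_omega_form cx).
  by rewrite (@ext_d_wedge R M 1 2 _ _ c x u etaF omega_form cx omega_closed).
have [A uA hA] := point_coframe cx lam_gt0.
rewrite (hodge_omega2 uA hA) -signr_odd mul1r; congr (_ * _); ring.
Qed.

(** On the frame vectors 0, 1, 2 the value is 1/lam. *)
Lemma eta_omega_neq0 c x : chart_codom c x ->
  exists v, (wedge_form eta omega : dform M 3) c x v != 0.
Proof.
move=> cx; have [A uA hA] := point_coframe cx lam_gt0.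
pose f (i : 'I_3) := frame A i; exists f.
rewrite (eta_omega_ieval hA) mulf_neq0 ?invr_neq0 ?gt_eqF //.
rewrite (_ : ieval _ _ _ = 1) ?oner_eq0 //.
rewrite /ieval /iwedge /= !big_cons big_nil /= !emon3E !coframe_frame //=.
by rewrite !(mulr0, mul0r, subr0, addr0, mulr1).
Qed.

End ContactCalabiYau.

(** * The flow *)

Section FlowParameter.
Context {R : realType}.
Variable eps : R.
Hypothesis eps_gt0 : 0 < eps.
Local Notation T := (1 / (8%:R * eps ^+ 2)).
Local Notation r t := (1 - 8%:R * eps ^+ 2 * t).
Local Notation q := (fun t : R => r t `^ (- (1 / 2%:R))).

Lemma flow_base_gt0 t : t < T -> 0 < r t.
Proof.
by rewrite ltr_pdivlMr ?mulr_gt0 ?exprn_gt0 // mulrC subr_gt0.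
Qed.

Lemma flow_base_T : r T = 0.
Proof.
by rewrite mul1r mulfV ?subrr // mulf_neq0 ?pnatr_eq0 // expf_neq0 // gt_eqF.
Qed.

Lemma flow_speed_gt0 t : t < T -> 0 < eps * q t.
Proof. by move=> tT; rewrite mulr_gt0 // powR_gt0 // flow_base_gt0. Qed.

(** This algebraic relation stands in for the real power, both in the derivative of q and in its
    divergence. *)
Lemma flow_speed_sqr t : t < T -> q t ^+ 2 * r t = 1.
Proof.
move=> /flow_base_gt0 r0; rewrite expr2 -powRD; last by apply/implyP => _; rewrite gt_eqF.
by rewrite -opprD -splitr powR_inv1 ?mulVf ?gt_eqF // ltW.
Qed.

Lemma flow_speed_derive t : t < T ->
  is_derive t (1 : R) (fun s => eps * q s : R^o) (4%:R * (eps * q t) ^+ 3 : R^o).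
Proof.
move=> tT; have r0 := flow_base_gt0 tT.
have dr : is_derive t (1 : R) (fun s => r s : R^o) (- (8%:R * eps ^+ 2)).
  have := is_deriveB (is_derive_cst (1 : R^o) t (1 : R))
    (is_deriveZ (8%:R * eps ^+ 2) (is_derive_id t (1 : R))).
  by rewrite sub0r [_ *: 1]mulr1.
have := is_deriveZ eps (@is_derive1_comp R (fun y => y `^ (- (1 / 2%:R)))
  (fun s => r s) t _ _ (is_derive1_powR (- (1 / 2%:R)) r0) dr).
(* r^(-3/2) = q r^-1, and r^-1 = q^2. *)
have -> : r t `^ (- (1 / 2%:R) - 1) = q t * (q t ^+ 2).
  rewrite powRB; last by apply/implyP => _; rewrite gt_eqF.
  rewrite powRr1 ?ltW //; congr (_ * _).
  by apply: (mulIf (lt0r_neq0 r0)); rewrite mulVf ?gt_eqF // flow_speed_sqr.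
move=> dq; apply: (is_derive_eq dq); rewrite -[LHS]/(_ * _).
move: (q t) => y; rewrite exprMn. 
have : (1 / 2%:R) * 2%:R = 1 :> R by rewrite mul1r mulVf.
move: (1 / 2%:R) => h h2.
(* The 4 is the exponent -1/2 times the -8 from the derivative of the base; [h] stands for 1/2. *)
have -> : 4%:R = 8%:R * h :> R by lra.
ring.
Qed.

(** A limit would force q to converge to some L; then q^2 r would tend to L^2 times 0, although it
    is constantly 1 before T. Here [w] and [b] are the values of eta /\ omega and Re Ups on fixed
    vectors. *)
Lemma flow_speed_diverges (w b l : R) : w != 0 ->
  ~ (eps * q t * w + b @[t --> T^'-] --> l).
Proof.
move=> w0 cvl.
have rT : r t @[t --> T^'-] --> (0 : R).
  rewrite -flow_base_T; apply: cvg_at_left_filter.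
  apply: cvgB; first exact: cvg_cst.
  by apply: cvgM; [exact: cvg_cst|exact: cvg_id].
pose L := (l - b) / (eps * w).
have qL : q t @[t --> T^'-] --> L.
  have : ((eps * q t * w + b) - b) / (eps * w) @[t --> T^'-] --> L.
    by apply: cvgM; [apply: cvgB => //; exact: cvg_cst|exact: cvg_cst].
  apply: cvg_trans; apply: near_eq_cvg; near=> t.
  have ew : eps * w != 0 by rewrite mulf_neq0 // gt_eqF.
  rewrite addrK; apply: (canLR (mulfK ew)); move: (q t) => y; ring.
have : q t ^+ 2 * r t @[t --> T^'-] --> L ^+ 2 * 0.
  by apply: cvgM => //; rewrite !expr2; apply: cvgM.
rewrite mulr0 => c0.
have c1 : q t ^+ 2 * r t @[t --> T^'-] --> (1 : R).
  apply: (@cvg_trans _ ((fun=> (1 : R)) t @[t --> T^'-])); last exact: cvg_cst.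
  apply: near_eq_cvg; near=> t.
  by rewrite flow_speed_sqr //; near: t; exact: nbhs_left_lt.
have E : (0 : R) = 1 by exact: (cvg_unique (@Rhausdorff R) c0 c1).
by have := oner_neq0 R; rewrite -E eqxx.
Unshelve. all: by end_near. Qed.

End FlowParameter.

Theorem theorem2 (R : realType) (M : smooth_manifold7 R)
    (g0 : bilinear_field M) (eta0 : dform M 1) (Ups0 : cform M 3)
    (hM : contact_calabi_yau g0 eta0 Ups0) (eps : R) (heps : 0 < eps) :
  let omega0 : dform M 2 := ext_d eta0 in
  let T : R := 1 / (8%:R * eps ^+ 2) in
  let q : R -> R := fun t => (1 - 8%:R * eps ^+ 2 * t) `^ (- (1 / 2%:R)) in
  let phi0 : dform M 3 := eps *: (wedge_form eta0 omega0 : dform M 3) + re_form Ups0 in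
  let phi : R -> dform M 3 := fun t =>
    (eps * q t) *: (wedge_form eta0 omega0 : dform M 3) + re_form Ups0 in
  let psi : R -> dform M 4 := fun t =>
    (1 / 2%:R) *: (wedge_form omega0 omega0 : dform M 4)
    - (eps * q t) *: (wedge_form eta0 (im_form Ups0) : dform M 4) in
  let g : R -> bilinear_field M := fun t c x u v =>
    eps ^+ 2 * q t ^+ 2 * (eval1 eta0 c x u * eval1 eta0 c x v)
    + transverse_metric g0 eta0 c x u v in
  let vol : R -> dform M 7 := fun t =>
    (eps * q t) *: (wedge_form eta0 (volD eta0) : dform M 7) in
  [/\ (forall t, t < T ->
         coclosed_g2_structure (phi t) (g t) (vol t) (psi t)),
      laplacian_flow [set t | t < T] phi,
      phi 0 = phi0,
      [set t | t <= 0] `<=` [set t | t < T] &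
      finite_time_singularity T phi].
Proof.
move: hM => [xi [Phi [S [UpsF Ups30] _ closedU volU]]] omega0 T q phi0 phi psi g vol.
have T0 : 0 < T by rewrite /T mul1r invr_gt0 mulr_gt0 // exprn_gt0.
have gE t : g t = cmet g0 eta0 (eps * q t).
  by apply/funext => c; apply/funext => x; apply/funext => u; apply/funext => v;
    rewrite /g /cmet exprMn.
have coclosed t : t < T -> coclosed_g2_structure (phi t) (g t) (vol t) (psi t).
  move=> tT; rewrite gE.
  exact: (cphi_coclosed S UpsF Ups30 closedU volU (flow_speed_gt0 heps tT)).
(* At each point a single triple of vectors already has no limiting value; this rules out both a
   limiting G2-structure and a continuation to T. *)
have no_limit c x : chart_codom c x -> exists v, forall l : R,
    ~ (phi t c x v @[t --> T^'-] --> l).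
  move=> cx; have [v v0] := eta_omega_neq0 S UpsF Ups30 volU heps cx.
  exists v => l; exact: (flow_speed_diverges heps v0).
split.
- exact: coclosed.
- move=> t tT; have [G2 gvol _ _] := coclosed t tT; split => //.
  exists (g t), (vol t); split => // c x cx v.
  rewrite gE (laplacian_cphi S UpsF Ups30 closedU volU (flow_speed_gt0 heps tT) v cx).
  have dq := is_derive_mulr_cst ((wedge_form eta0 omega0 : dform M 3) c x v)
    (flow_speed_derive heps tT).
  have := is_deriveD dq (is_derive_cst (re_form Ups0 c x v : R^o) t (1 : R)).
  by rewrite addr0.
- by rewrite /phi /q mulr0 subr0 powR1 mulr1.
- by move=> t /= t0; exact: le_lt_trans T0.
- split=> [c x cx [a [_ cva]]|[phi' [phi'E _ phi'T]]].
    have [v nol] := no_limit c x cx; exact: nol (cva v).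
  (* A continuation is refuted at one point, which exists since [M] is nonempty; its left limit at T
     would be a limit of [phi], with which it agrees before T. *)
  have [p _] := mfd_nonempty M; have [c cp] := dom_cover p.
  have cx := coord_codom cp; have [v nol] := no_limit c _ cx.
  apply: (nol (phi' T c (chart_map c p) v)).
  apply: cvg_trans (phi'T c _ cx v); apply: near_eq_cvg; near=> t.
  by apply: phi'E => //; near: t; exact: nbhs_left_lt.
Unshelve. all: by end_near. Qed.
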